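(* Let $r$ be a positive integer and let $\Sigma$ be valid with $U_r(\Sigma)$ bounded. Let $Q_1,Q_2\le G_r(\Sigma)$ be finite subgroups with $Q_1\cong Q_2$. Then $Q_1$ and $Q_2$ are conjugate in $G_r(\Sigma)$ if and only if $\pi(Q_1)=\pi(Q_2)$. In particular, there are only finitely many conjugacy classes in $G_r(\Sigma)$ of subgroups isomorphic to $Q_1$.
   Context: Cantor algebras. Fix finitely many colours $\{1,\ldots,s\}$, each colour $i$ having an arity, an integer $n_i>1$. An $\Omega$-algebra is a set $U$ with, for each colour $i$, an $n_i$-ary operation $\lambda_i:U^{n_i}\to U$ and $n_i$ unary operations $\alpha_i^1,\ldots,\alpha_i^{n_i}:U\to U$ (operations act on the right); write $v\alpha_i=(v\alpha_i^1,\ldots,v\alpha_i^{n_i})$. For a subset $Y$, a simple expansion of colour $i$ replaces one element $y\in Y$ by the $n_i$ elements $y\alpha_i^1,\ldots,y\alpha_i^{n_i}$; a simple contraction of colour $i$ replaces $n_i$ distinct elements $a_1,\ldots,a_{n_i}$ of $Y$ by the single element $(a_1,\ldots,a_{n_i})\lambda_i$. Let $X$ be a finite set with $|X|=r$ and $W_\Omega(X)$ the free $\Omega$-algebra on $X$. A subset of $W_\Omega(X)$ (or of a quotient of it) is admissible if it is obtained from $X$ (or its image) by finitely many simple expansions and contractions. Let $\Sigma=\Sigma_1\cup\Sigma_2$, where $\Sigma_1$ consists of the laws $u\alpha_i\lambda_i=u$ and $(u_1,\ldots,u_{n_i})\lambda_i\alpha_i=(u_1,\ldots,u_{n_i})$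 for all colours $i$, and $\Sigma_2=\bigcup_{1\le i<i'\le s}\Sigma_2^{i,i'}$, where each $\Sigma_2^{i,i'}$ is either empty or is of the following form: for some maps $f:\{1,\ldots,n_i\}\to\{1,\ldots,s\}$ and $f':\{1,\ldots,n_{i'}\}\to\{1,\ldots,s\}$ put $\Lambda_i=\{\alpha_i^j\alpha_{f(j)}^k: 1\le j\le n_i,\,1\le k\le n_{f(j)}\}$ and $\Lambda_{i'}=\{\alpha_{i'}^j\alpha_{f'(j)}^k: 1\le j\le n_{i'},\,1\le k\le n_{f'(j)}\}$ (sets of length 2 sequences of descending operations), fix a bijection $\phi:\Lambda_i\to\Lambda_{i'}$, and let $\Sigma_2^{i,i'}$ be the set of laws $u\nu=u\phi(\nu)$, $\nu\in\Lambda_i$. The Cantor algebra $U_r(\Sigma)$ is the quotient of $W_\Omega(X)$ by the fully invariant congruence generated by $\Sigma$. $\Sigma$ (or $U_r(\Sigma)$) is valid if every admissible $Y\subseteq W_\Omega(X)$ has the same cardinality as its image in $U_r(\Sigma)$. In that case $U_r(\Sigma)$ is free on $X$ in the class of $\Omega$-algebras satisfying $\Sigma$, and every admissible subset is a basis. For admissible subsets $Y,Z$ of $U_r(\Sigma)$ write $Y\le Z$ if $Z$ is obtained from $Y$ by a finite number of simple expansions. The set $\mathfrak{A}_r(\Sigma)$ of admissible subsets of $U_r(\Sigma)$ is a poset under $\le$. $U_r(\Sigma)$ is bounded if for all admissible $B,C$ for which there is an admissible $A$ with $A\le B$ and $A\le C$, there is a unique least upper bound of $B$ and $C$, i.e.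 an admissible $T$ with $B\le T$, $C\le T$ and $T\le S$ for every admissible $S$ with $B\le S$, $C\le S$. $G_r(\Sigma)$ is the group of those $\Omega$-algebra automorphisms of $U_r(\Sigma)$ which are induced by a bijection $V\to W$ between admissible subsets of the same cardinality; it acts on the right on $\mathfrak{A}_r(\Sigma)$ by $Y\mapsto Yg$. For $Q\le G_r(\Sigma)$, $\mathfrak{A}_r(\Sigma)^Q$ is the set of admissible $Y$ with $Yq=Y$ for all $q\in Q$; such a $Y$ is a finite $Q$-set. The invariant $\pi(Q)$. Put $d=\gcd\{n_i-1: i=1,\ldots,s\}$. For a finite subgroup $Q$, list the isomorphism types of transitive $Q$-sets (transitive permutation representations of $Q$) as types $1,\ldots,t$. There is a unique tuple $\pi(Q)=\{r_1,\ldots,r_t\}$ of integers with $0\le r_j\le d$, indexed by the types, such that some $Y\in\mathfrak{A}_r(\Sigma)^Q$ has exactly $r_j$ orbits of type $j$ for each $j$. For isomorphic finite subgroups $Q_1,Q_2$, $\pi(Q_1)=\pi(Q_2)$ means that there is an isomorphism $Q_1\to Q_2$ such that, when the types of transitive $Q_1$-sets are identified with the types of transitive $Q_2$-sets via this isomorphism, the corresponding integers agree. *)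

(* Defs.v *)
From HB Require Import structures.
From Stdlib Require Import Relation_Operators ClassicalEpsilon.
From mathcomp Require Import all_boot.
From mathcomp Require Import generic_quotient.
From mathcomp Require Import boolp classical_sets functions cardinality.

Set Implicit Arguments.
Unset Strict Implicit.
Unset Printing Implicit Defensive.

Local Open Scope classical_set_scope.
Local Open Scope card_scope.
Local Open Scope quotient_scope.

(* Operations act on the right in the mathematics: [u alpha_i^j] is written   *)
(* [alp i j u] and [(a_1, ..., a_{n_i}) lambda_i] is written [lam i a].       *)
Record omega_alg (s : nat) (n : 'I_s -> nat) := OmegaAlg {
  carrier :> Type;
  lam : forall i : 'I_s, ('I_(n i) -> carrier) -> carrier;
  alp : forall i : 'I_s, 'I_(n i) -> carrier -> carrier
}.
Arguments lam {s n o} i a.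
Arguments alp {s n o} i j u.

Section Expansions.
Variables (s : nat) (n : 'I_s -> nat) (A : omega_alg n).
Implicit Types (Y Z : set A) (i : 'I_s).

Definition simple_expansion i Y Z : Prop :=
  exists2 y, Y y & Z = (Y `\ y) `|` range (fun j => alp i j y).

Definition simple_contraction i Y Z : Prop :=
  exists a : 'I_(n i) -> A, [/\ injective a, range a `<=` Y
    & Z = (Y `\` range a) `|` [set lam i a]].

(* [admissible_from X Y]: Y is obtained from X by finitely many moves. *)
Definition admissible_from : set A -> set A -> Prop :=
  clos_refl_trans (set A) (fun Y Z =>
    exists i, simple_expansion i Y Z \/ simple_contraction i Y Z).

Definition expands : set A -> set A -> Prop :=
  clos_refl_trans (set A) (fun Y Z => exists i, simple_expansion i Y Z).

End Expansions.

(* The free Omega-algebra W_Omega(X): the algebra of terms over X. *)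
Inductive term (s : nat) (n : 'I_s -> nat) (X : Type) : Type :=
| Gen of X
| Lam (i : 'I_s) of ('I_(n i) -> term n X)
| Alp (i : 'I_s) of 'I_(n i) & term n X.
Arguments Gen {s n X}.
Arguments Lam {s n X}.
Arguments Alp {s n X}.

Definition free_alg (s : nat) (n : 'I_s -> nat) (X : Type) : omega_alg n :=
  OmegaAlg (@Lam s n X) (@Alp s n X).

(* The endomorphism of W_Omega(X) extending h : X -> W_Omega(X). *)
Fixpoint subst (s : nat) (n : 'I_s -> nat) (X : Type) (h : X -> term n X)
    (t : term n X) : term n X :=
  match t with
  | Gen x => h x
  | Lam i a => Lam i (fun j => subst h (a j))
  | Alp i j u => Alp i j (subst h u)
  end.

(* The data (f, f', phi) of a nonempty Sigma_2^{i,i'}. The pair (j, k) stands *)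
(* for the sequence alpha_i^j alpha_{f(j)}^k, which determines j and k, so    *)
(* [word2 f] is in bijection with the set Lambda_i of such sequences.         *)
Definition word2 (s : nat) (n : 'I_s -> nat) (i : 'I_s)
  (f : 'I_(n i) -> 'I_s) : Type := {j : 'I_(n i) & 'I_(n (f j))}.

Record law2 (s : nat) (n : 'I_s -> nat) (i i' : 'I_s) := Law2 {
  law_f : 'I_(n i) -> 'I_s;
  law_f' : 'I_(n i') -> 'I_s;
  law_phi : word2 law_f -> word2 law_f';
  law_phi_bij : bijective law_phi
}.

(* [None] encodes an empty Sigma_2^{i,i'}; only the values at i < i' matter. *)
Definition sigma2 (s : nat) (n : 'I_s -> nat) : Type :=
  forall i i' : 'I_s, option (law2 n i i').

Definition act_word2 (s : nat) (n : 'I_s -> nat) (X : Type) (i : 'I_s)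
    (f : 'I_(n i) -> 'I_s) (u : term n X) (nu : word2 f) : term n X :=
  Alp (f (tag nu)) (tagged nu) (Alp i (tag nu) u).

(* The fully invariant congruence on W_Omega(X) generated by Sigma. *)
Inductive sigma_cong (s : nat) (n : 'I_s -> nat) (S2 : sigma2 n) (X : Type) :
    term n X -> term n X -> Prop :=
| SC_refl t : sigma_cong S2 t t
| SC_sym t u : sigma_cong S2 t u -> sigma_cong S2 u t
| SC_trans t u v :
    sigma_cong S2 t u -> sigma_cong S2 u v -> sigma_cong S2 t v
| SC_lam i (a b : 'I_(n i) -> term n X) :
    (forall j, sigma_cong S2 (a j) (b j)) ->
    sigma_cong S2 (Lam i a) (Lam i b)
| SC_alp i (j : 'I_(n i)) t u :
    sigma_cong S2 t u -> sigma_cong S2 (Alp i j t) (Alp i j u)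
| SC_subst (h : X -> term n X) t u :
    sigma_cong S2 t u -> sigma_cong S2 (subst h t) (subst h u)
| SC_alp_lam i u : sigma_cong S2 (Lam i (fun j => Alp i j u)) u
| SC_lam_alp i (a : 'I_(n i) -> term n X) j :
    sigma_cong S2 (Alp i j (Lam i a)) (a j)
| SC_law2 i i' (L : law2 n i i') (nu : word2 (law_f L)) u :
    (i < i')%N -> S2 i i' = Some L ->
    sigma_cong S2 (act_word2 u nu) (act_word2 u (law_phi nu)).

HB.instance Definition _ (s : nat) (n : 'I_s -> nat) (X : Type) :=
  gen_eqMixin (term n X).
HB.instance Definition _ (s : nat) (n : 'I_s -> nat) (X : Type) :=
  gen_choiceMixin (term n X).

Section Cantor.
Variables (s : nat) (n : 'I_s -> nat) (S2 : sigma2 n) (X : finType).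

Definition sigma_rel : rel (term n X) := fun t u => `[< sigma_cong S2 t u >].

Lemma sigma_rel_equiv : equiv_class_of sigma_rel.
Proof.
split=> [t | t u | u t v].
- exact/asboolP/SC_refl.
- by apply/asboolP/asboolP; exact: SC_sym.
- by move=> /asboolP tu /asboolP uv; apply/asboolP; exact: SC_trans tu uv.
Qed.

Canonical sigma_equiv := EquivRelPack sigma_rel_equiv.

Definition cantor_carrier := {eq_quot sigma_equiv}.

(* U_r(Sigma), with r = #|X|. *)
Definition cantor : omega_alg n := @OmegaAlg s n cantor_carrier
  (fun i a => \pi_cantor_carrier (Lam i (fun j => repr (a j))))
  (fun i j u => \pi_cantor_carrier (Alp i j (repr u))).

Definition to_cantor (t : free_alg n X) : cantor := \pi_cantor_carrier t.

Definition free_admissible : set (set (free_alg n X)) :=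
  [set Y | admissible_from (range (Gen : X -> free_alg n X)) Y].

Definition admissible : set (set cantor) :=
  [set Y | admissible_from (range (fun x => to_cantor (Gen x))) Y].

Definition valid : Prop :=
  forall Y, free_admissible Y -> Y #= (to_cantor @` Y).

Definition is_lub (B C T : set cantor) : Prop :=
  [/\ admissible T, expands B T, expands C T &
    forall S, admissible S -> expands B S -> expands C S -> expands T S].

Definition bounded : Prop := forall A B C,
  admissible A -> admissible B -> admissible C ->
  expands A B -> expands A C -> exists! T, is_lub B C T.

End Cantor.

Record omega_aut (s : nat) (n : 'I_s -> nat) (A : omega_alg n) := Aut {
  aut_fun :> A -> A;
  aut_inv : A -> A;
  aut_funK : cancel aut_fun aut_inv;
  aut_invK : cancel aut_inv aut_fun;
  aut_lam : forall i (a : 'I_(n i) -> A),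
    aut_fun (lam i a) = lam i (fun j => aut_fun (a j));
  aut_alp : forall i (j : 'I_(n i)) u, aut_fun (alp i j u) = alp i j (aut_fun u)
}.

Section AutGroup.
Variables (s : nat) (n : 'I_s -> nat) (A : omega_alg n).
Implicit Types g h k : omega_aut A.

Lemma aut_eq g h : aut_fun g =1 aut_fun h -> g = h.
Proof.
case: g h => [f f' fK f'K fl fa] [e e' eK e'K el ea] /= /funext fe.
subst e; have e'E : e' = f'.
  by apply/funext => u; rewrite -[u in RHS]e'K fK.
by subst e'; congr Aut; exact: Prop_irrelevance.
Qed.

Definition aut_one : omega_aut A :=
  @Aut s n A idfun idfun (fun=> erefl) (fun=> erefl)
    (fun _ _ => erefl) (fun _ _ _ => erefl).

(* Automorphisms act on the right: in [g * h], the factor [g] acts first. *)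
Definition aut_mul g h : omega_aut A.
Proof.
refine (@Aut s n A (h \o g) (aut_inv g \o aut_inv h) _ _ _ _).
- by move=> u /=; rewrite !aut_funK.
- by move=> u /=; rewrite !aut_invK.
- by move=> i a /=; rewrite !aut_lam.
- by move=> i j u /=; rewrite !aut_alp.
Defined.

Definition aut_inverse g : omega_aut A.
Proof.
refine (@Aut s n A (aut_inv g) g (@aut_invK _ _ _ g) (@aut_funK _ _ _ g) _ _).
- move=> i a; apply: (can_inj (@aut_funK _ _ _ g)).
  rewrite aut_invK aut_lam; congr (lam i); apply/funext => j; exact/esym/aut_invK.
- move=> i j u; apply: (can_inj (@aut_funK _ _ _ g)).
  by rewrite aut_alp !aut_invK.
Defined.

HB.instance Definition _ := gen_eqMixin (omega_aut A).
HB.instance Definition _ := gen_choiceMixin (omega_aut A).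

Lemma aut_mulA : associative aut_mul.
Proof. by move=> g h k; apply: aut_eq. Qed.
Lemma aut_mul1 : left_id aut_one aut_mul.
Proof. by move=> g; apply: aut_eq. Qed.
Lemma aut_mulr1 : right_id aut_one aut_mul.
Proof. by move=> g; apply: aut_eq. Qed.
Lemma aut_mulV : left_inverse aut_one aut_inverse aut_mul.
Proof. by move=> g; apply: aut_eq => u /=; exact: aut_invK. Qed.
Lemma aut_mulrV : right_inverse aut_one aut_inverse aut_mul.
Proof. by move=> g; apply: aut_eq => u /=; exact: aut_funK. Qed.

HB.instance Definition _ := isGroup.Build (omega_aut A)
  aut_mulA aut_mul1 aut_mulr1 aut_mulV aut_mulrV.

End AutGroup.

Section Groups.
Variable G : groupType.
Implicit Types (P Q H : set G).

Definition subgroup_of H Q : Prop := Q `<=` H /\ group_closed (mem Q).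

Definition group_iso P Q (psi : G -> G) : Prop :=
  set_bij P Q psi /\ {in P &, {morph psi : x y / (x * y)%g}}.

Definition isomorphic P Q : Prop := exists psi, group_iso P Q psi.

Definition conj_set Q (g : G) : set G := [set (q ^ g)%g | q in Q].

Definition conjugate_in H P Q : Prop := exists2 g, H g & Q = conj_set P g.

Definition conj_class H Q : set (set G) := [set P | conjugate_in H Q P].

(* Transitive (right) Q-sets; a transitive Q-set of a finite Q is finite.     *)
(* Only the action of elements of Q is meaningful.                            *)
Record trans_set Q := TransSet {
  ts_car :> finType;
  ts_act : ts_car -> G -> ts_car;
  ts_act1 : forall x, ts_act x 1%g = x;
  ts_actM : forall x p q, Q p -> Q q ->
    ts_act x (p * q)%g = ts_act (ts_act x p) q;
  ts_trans : exists x, forall y, exists2 q, Q q & ts_act x q = y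
}.

(* T1 and T2 have the same type once the types of transitive Q1-sets and      *)
(* those of transitive Q2-sets are identified via psi : Q1 -> Q2.             *)
Definition same_type (Q1 Q2 : set G) (psi : G -> G)
    (T1 : trans_set Q1) (T2 : trans_set Q2) : Prop :=
  exists2 b : T1 -> T2, bijective b &
    forall x q, Q1 q -> b (ts_act x q) = ts_act (b x) (psi q).

End Groups.

Section Thompson.
Variables (s : nat) (n : 'I_s -> nat) (S2 : sigma2 n) (X : finType).
Let U := cantor S2 X.

(* G_r(Sigma), as a set of automorphisms of U_r(Sigma). *)
Definition Gr : set (omega_aut U) :=
  [set g | exists V W, [/\ admissible V, admissible W & set_bij V W g]].

Definition fixed_admissible (Q : set (omega_aut U)) : set (set U) :=
  [set Y | admissible Y /\ forall q, Q q -> q @` Y = Y].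

Definition orbits (Q : set (omega_aut U)) (Y : set U) : set (set U) :=
  [set [set (q : omega_aut U) y | q in Q] | y in Y].

Definition of_type (Q : set (omega_aut U)) (T : trans_set Q) (O : set U) : Prop :=
  exists2 b : U -> T, set_bij O setT b &
    forall u q, O u -> Q q -> b (q u) = ts_act (b u) q.

Definition gcd_arities : nat := \big[gcdn/0%N]_(i < s) (n i).-1.

(* A tuple indexed by the types is given as a function on the transitive      *)
(* Q-sets; the cardinality clause makes it invariant under isomorphism.       *)
Definition is_pi (Q : set (omega_aut U)) (p : trans_set Q -> nat) : Prop :=
  (forall T, (p T <= gcd_arities)%N) /\
  exists2 Y, fixed_admissible Q Y &
    forall T, (orbits Q Y `&` [set O | of_type T O]) #= `I_(p T).

(* The tuple pi(Q): the unique p with is_pi Q p. *)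
Definition pi_inv (Q : set (omega_aut U)) : trans_set Q -> nat :=
  epsilon (inhabits (fun=> 0%N)) (is_pi (Q := Q)).

Definition pi_eq (Q1 Q2 : set (omega_aut U)) : Prop :=
  exists2 psi : omega_aut U -> omega_aut U, group_iso Q1 Q2 psi &
    forall (T1 : trans_set Q1) (T2 : trans_set Q2),
      same_type psi T1 T2 -> pi_inv T1 = pi_inv T2.

End Thompson.

Arguments Gr {s n} S2 X.

(* Main.v *)
Require Import Defs.
From Stdlib Require Import Relation_Operators ClassicalEpsilon.
From mathcomp Require Import all_boot.
From mathcomp Require Import generic_quotient finmap.
From mathcomp Require Import boolp classical_sets functions cardinality.

(* Admissible sets are bases of U, so any bijection between two of them       *)
(* extends to an automorphism, and each element of an expansion of Y descends *)
(* from exactly one element of Y.                                             *)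
(* Boundedness makes expansion confluent, so any two admissible sets have a   *)
(* common expansion; taking the least upper bound of the translates of one    *)
(* of them yields Q-fixed admissible sets, and common Q-fixed expansions.     *)
(* If Y <= S are both Q-fixed, an element of S has the same stabilizer as     *)
(* the element of Y it descends from, hence the number of orbits of each type *)
(* agrees for Y and S modulo d, and vanishes for both or for none.  Replacing *)
(* an orbit by its n_i images, or n_i orbits of one type by a single one,     *)
(* changes one such number by n_i - 1, so all of them can be brought into     *)
(* 0..d: this is pi(Q).  If pi(Q1) = pi(Q2), the two reduced fixed sets are   *)
(* isomorphic as Q1-sets, and the automorphism induced by an equivariant      *)
(* bijection conjugates Q1 to Q2.  There are finitely many possible values    *)
(* of pi on groups isomorphic to Q1, hence finitely many classes.             *)

Set Implicit Arguments.
Unset Strict Implicit.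
Unset Printing Implicit Defensive.

Local Open Scope classical_set_scope.
Local Open Scope card_scope.

Local Arguments alp : simpl never.
Local Arguments lam : simpl never.

(** * Cardinals of finite sets *)

(** Orbit types are compared through point stabilizers. Descendants of distinct basis elements never
    coincide ([basis_wact_inj]), so a descendant keeps the stabilizer of its ancestor, and expanding
    a fixed set preserves each orbit count modulo d and its vanishing ([cnt_expands]). Since fixed
    sets have common fixed expansions ([fixed_upper_bound]), counts in 0..d are unique
    ([cnt_unique]). They exist ([reduced_exists]) because [orbit_expansion] and [orbit_contraction]
    shift one count by n_i - 1, and [shift_gcdn] combines such shifts into a shift by d.

    Finite sets with equal orbit counts are equivariantly isomorphic ([equivariant_bijection]), and
    [conjugate_of_counts] turns this into conjugacy. That lemma compares two subgroups through a
    third group P, so that it serves both the equivalence and the finiteness clause. *)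

Lemma card_setU_disjoint (T : choiceType) (A B : set T) a b :
  A #= `I_a -> B #= `I_b -> A `&` B = set0 -> A `|` B #= `I_(a + b).
Proof.
move=> Aa Bb AB0.
have fA : finite_set A by exists a.
have fB : finite_set B by exists b.
rewrite -[_ `|` _]fset_setK ?finite_setU //; apply/card_eq_fsetP.
rewrite fset_setU // cardfsU -fset_setI // AB0 fset_set0 cardfs0 subn0.
by rewrite (card_fset_set Aa) (card_fset_set Bb).
Qed.

Section SetCardinal.
Context {T : Type}.
Implicit Types A B : set T.

(** An infinite set gets the default value 0, hence the finiteness hypotheses below. *)
Definition ncard A : nat := xget 0%N [set m | A #= `I_m].

Lemma ncardP A : finite_set A -> A #= `I_(ncard A).
Proof. by move=> fA; apply: (@xgetPex _ 0%N [set m | A #= `I_m]). Qed.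

Lemma ncard_unique A m : A #= `I_m -> ncard A = m.
Proof.
move=> Am; have /ncardP Ac : finite_set A by exists m.
by apply/card_eq_II; rewrite -(card_eql Ac).
Qed.

Lemma ncard_set0 : ncard (set0 : set T) = 0%N.
Proof. by apply: ncard_unique; rewrite II0 card_eq00. Qed.

Lemma ncard_eq0 A : finite_set A -> ncard A = 0%N -> A = set0.
Proof.
move=> /ncardP + A0; rewrite A0 II0 => ?.
by apply/eqP; rewrite -(@card_eq0 _ nat).
Qed.

Lemma ncard_set1 (x : T) : ncard [set x] = 1%N.
Proof. by apply: ncard_unique; rewrite card_set1. Qed.

Lemma ncardU A B : finite_set A -> finite_set B -> A `&` B = set0 ->
  ncard (A `|` B) = (ncard A + ncard B)%N.
Proof.
move=> fA fB AB0; apply: ncard_unique.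
exact: (@card_setU_disjoint {classic T} A B _ _ (ncardP fA) (ncardP fB) AB0).
Qed.

Lemma ncardD1 A (x : T) : finite_set A -> A x ->
  ncard A = (ncard (A `\ x)).+1.
Proof.
move=> fA Ax; rewrite -{1}(setD1K Ax) ncardU //; first by rewrite ncard_set1.
- exact: finite_setD.
- by apply/seteqP; split=> // y [-> [_]]; apply.
Qed.

End SetCardinal.

Lemma ncard_eq {T U : Type} (A : set T) (B : set U) : A #= B -> ncard A = ncard B.
Proof. by move=> AB; congr xget; apply/seteqP; split=> m /=; rewrite (card_eql AB). Qed.

Lemma ncard_image {T U : Type} (f : T -> U) (A : set T) :
  {in A &, injective f} -> ncard (f @` A) = ncard A.
Proof. by move=> /inj_card_eq/ncard_eq. Qed.

Lemma ncard_range {k} {U : Type} (f : 'I_k -> U) :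
  injective f -> ncard (range f) = k.
Proof.
move=> fI; apply: ncard_unique; rewrite (card_eqr card_II).
by apply: inj_card_eq => x y _ _; exact: fI.
Qed.

Lemma card_eq_set_bij {T U : Type} (A : set T) (B : set U) (y : U) :
  A #= B -> exists f, set_bij A B f.
Proof.
move=> /card_bijP[f [g fK gK]].
pose F x := if pselect (x \in A) is left Ax then val (f (SigSub Ax)) else y.
exists F; split.
- move=> x /mem_set Ax; rewrite /F; case: pselect => // Ax'.
  exact: set_valP.
- move=> x x' Ax Ax'; rewrite /F; case: pselect => // p; case: pselect => // p'.
  by move=> /val_inj /(can_inj fK) /(congr1 val).
- move=> z /mem_set Bz; exists (val (g (SigSub Bz))); first exact: set_valP.
  rewrite /F; case: pselect => [p|[]]; last exact: valP.
  by rewrite (_ : SigSub p = g (SigSub Bz)) ?gK //; apply: val_inj.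
Qed.

Lemma finite_set_ind (T : Type) (K : set T -> Prop) :
  K set0 -> (forall x P, finite_set P -> ~ P x -> K P -> K (x |` P)) ->
  forall P, finite_set P -> K P.
Proof.
move=> K0 KU P; pose P' : set {classic T} := P.
move=> /(@finite_seqP _ P')[l Pl]; rewrite -/P' Pl {P P' Pl}.
elim: l => [|x l IH]; first by rewrite set_nil.
have -> : [set` x :: l] = x |` [set` l].
  apply/seteqP; split=> y; rewrite /= inE; first by move=> /orP[/eqP|]; auto.
  by move=> [->|->]; rewrite ?eqxx ?orbT.
case: (pselect ([set` l] x)) => lx.
  by rewrite setUidr // => ? ->.
by apply: KU => //; exact: (@finite_seq {classic T}).
Qed.

Lemma ncard_eq0P (V : Type) (K : set V) : finite_set K -> ncard K = 0 <-> ~ (K !=set0).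
Proof.
move=> fK; rewrite nonemptyPn; split; first exact: ncard_eq0.
by move=> ->; exact: ncard_set0.
Qed.

(** * Bases and admissible sets *)

Section Bases.
Variables (s : nat) (n : 'I_s -> nat) (A : omega_alg n).
Hypothesis lam_alpK : forall i (u : A), lam i (fun j => alp i j u) = u.
Hypothesis alp_lamK : forall i (a : 'I_(n i) -> A) j, alp i j (lam i a) = a j.
Hypothesis A_nontrivial : exists u v : A, u <> v.
Hypothesis arity_gt1 : forall i, 1 < n i.
Implicit Types (Y Z P : set A) (i : 'I_s) (u v y : A).

Definition is_endo (f : A -> A) : Prop :=
  (forall i a, f (lam i a) = lam i (fun j => f (a j))) /\
  (forall i (j : 'I_(n i)) u, f (alp i j u) = alp i j (f u)).

(* Only maps into the algebra itself ever have to be extended, so freeness   *)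
(* on [Y] is expressed with endomorphisms alone.                             *)
Definition is_basis Y : Prop :=
  (forall h : A -> A, exists2 f, is_endo f & forall y, Y y -> f y = h y) /\
  (forall f g, is_endo f -> is_endo g -> (forall y, Y y -> f y = g y) -> f =1 g).

Definition word : Type := seq {i : 'I_s & 'I_(n i)}.

Definition wact u (w : word) : A :=
  foldl (fun v x => alp (tag x) (tagged x) v) u w.

Definition descendants Y : set A := [set wact y w | y in Y & w in @setT word].

Lemma wact_rcons u w x : wact u (rcons w x) = alp (tag x) (tagged x) (wact u w).
Proof. by rewrite /wact foldl_rcons. Qed.

Lemma endo_wact f u w : is_endo f -> f (wact u w) = wact (f u) w.
Proof.
by move=> fE; elim/last_ind: w => // w x IH; rewrite !wact_rcons fE.2 IH.
Qed.

Lemma wact_surj w v : exists u, wact u w = v.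
Proof.
elim: w v => [|x w IH] v; first by exists v.
have [u uv] := IH v; exists (lam (tag x) (fun=> u)).
by rewrite /= alp_lamK.
Qed.

Lemma lam_inj i (a b : 'I_(n i) -> A) : lam i a = lam i b -> a =1 b.
Proof. by move=> ab j; rewrite -(alp_lamK a) ab alp_lamK. Qed.

(** Descending words act surjectively, so freeness gives an endomorphism sending [y] to a
    [w]-preimage of [u] and [y'] to a [w']-preimage of [v]; a coincidence of the descendants would
    force [u = v]. *)
Lemma basis_wact_inj Y y y' w w' : is_basis Y -> Y y -> Y y' ->
  wact y w = wact y' w' -> y = y'.
Proof.
move=> [Yfree _] Yy Yy' e; apply: contrapT => yy'.
have [u [v uv]] := A_nontrivial.
have [u' uu'] := wact_surj w u.
have [v' vv'] := wact_surj w' v.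
have [f fE fY] := Yfree (fun z => if `[< z = y >] then u' else v').
apply: uv; have := congr1 f e; rewrite !endo_wact // !fY //.
by rewrite asboolT // asboolF ?uu' ?vv' // => /esym.
Qed.

Lemma basis_alp_inj Y y i : is_basis Y -> Y y -> injective (fun j => alp i j y).
Proof.
move=> [Yfree _] Yy j k e; apply: contrapT => jk.
have [u [v uv]] := A_nontrivial.
have [f fE fY] := Yfree (fun=> lam i (fun l => if l == j then u else v)).
apply: uv; have := congr1 f e; rewrite !fE.2 fY // !alp_lamK eqxx.
by case: eqP => // /esym.
Qed.

Lemma basis_notin_alp Y y y' i j : is_basis Y -> Y y -> Y y' ->
  alp i j y = y' -> y = y'.
Proof.
by move=> Yb Yy Yy' e; apply: (@basis_wact_inj Y y y' [:: Tagged _ j] [::]).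
Qed.

(** Prescribing values at the children of [y] amounts to prescribing the value at [y], namely [lam]
    of the prescribed tuple. *)
Lemma basis_expansion i Y Z :
  is_basis Y -> simple_expansion i Y Z -> is_basis Z.
Proof.
move=> [Yfree Ygen] [y Yy ->]; split=> [h|f g fE gE fg].
  pose h' u := if `[< u = y >] then lam i (fun j => h (alp i j y)) else h u.
  have [f fE fY] := Yfree h'; exists f => // z [[Yz zy]|[j _ <-]].
    by rewrite fY // /h' asboolF.
  by rewrite fE.2 fY // /h' asboolT // alp_lamK.
apply: Ygen => // u Yu; case: (pselect (u = y)) => [->|uy]; last by apply: fg; left.
rewrite -(lam_alpK i y) fE.1 gE.1; congr lam; apply/funext => j.
by apply: fg; right; exists j.
Qed.

Lemma basis_contraction i Y Z :
  is_basis Y -> simple_contraction i Y Z -> is_basis Z.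
Proof.
move=> [Yfree Ygen] [a [aI aY ->]]; split=> [h|f g fE gE fg].
  pose h' u := if pselect (exists j, a j = u) is left p
    then alp i (projT1 (cid p)) (h (lam i a)) else h u.
  have h'a j : h' (a j) = alp i j (h (lam i a)).
    rewrite /h'; case: pselect => [p|[]]; last by exists j.
    by case: cid => /= k /aI ->.
  have [f fE fY] := Yfree h'; exists f => // z [[Yz zy]|->].
    by rewrite fY // /h'; case: pselect => // p; case: zy; case: p => j ja; exists j.
  rewrite fE.1 -[RHS](lam_alpK i); congr lam; apply/funext => j.
  by rewrite fY ?h'a //; apply: aY; exists j.
apply: Ygen => // u Yu; case: (pselect (range a u)) => [[j _ <-]|ua]; last first.
  by apply: fg; left.
have /(congr1 (alp i j)) : f (lam i a) = g (lam i a) by apply: fg; right.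
by rewrite -fE.2 -gE.2 !alp_lamK.
Qed.

(** The children of [y] avoid the rest of the basis, so contracting them removes nothing else. *)
Lemma expansion_sym i Y Z :
  is_basis Y -> simple_expansion i Y Z -> simple_contraction i Z Y.
Proof.
move=> Yb [y Yy ->]; exists (fun j => alp i j y); split.
- exact: basis_alp_inj Yb Yy.
- by move=> _ [j _ <-]; right; exists j.
rewrite lam_alpK; apply/seteqP; split=> u.
  move=> Yu; case: (pselect (u = y)) => [->|uy]; [by right | left].
  split; first by left.
  move=> [j _ /(basis_notin_alp Yb Yy Yu)]; exact/nesym.
by move=> [[[[]|//]]|-> //].
Qed.

Lemma contraction_sym i Y Z :
  is_basis Y -> simple_contraction i Y Z -> simple_expansion i Z Y.
Proof.
move=> Yb [a [aI aY ->]]; exists (lam i a); first by right.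
have -> : (fun j => alp i j (lam i a)) = a by apply/funext => j; rewrite alp_lamK.
apply/seteqP; split=> u.
  move=> Yu; case: (pselect (range a u)) => [|ua]; [by right | left].
  split; first by left.
  (* If [lam i a] already lay in [Y], it would equal its child [a j], another basis element, and so
     lie in the range of [a]. *)
  move=> ula; have := aY (a (Ordinal (ltnW (arity_gt1 i)))) (ex_intro2 _ _ _ I erefl).
  set j := Ordinal _ => Yaj; apply: ua; exists j => //.
  by apply/esym/(@basis_notin_alp Y u (a j) i j Yb) => //; rewrite ula alp_lamK.
by move=> [[[[]|//]]|/aY//].
Qed.

Definition elementary_move Y Z : Prop :=
  exists i, simple_expansion i Y Z \/ simple_contraction i Y Z.

Lemma elementary_move_sym Y Z : is_basis Y -> elementary_move Y Z -> elementary_move Z Y.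
Proof.
move=> Yb [i [YZ|YZ]]; exists i.
- by right; exact: expansion_sym.
- by left; exact: contraction_sym.
Qed.

Lemma elementary_move_basis Y Z : is_basis Y -> elementary_move Y Z -> is_basis Z.
Proof.
move=> Yb [i []]; [exact: basis_expansion | exact: basis_contraction].
Qed.

Lemma admissible_from_basis Y Z : is_basis Y -> admissible_from Y Z -> is_basis Z.
Proof.
move=> + YZ; elim: YZ => // [? ? m Yb|? ? ? _ IH1 _ IH2 Yb]; last by auto.
exact: elementary_move_basis m.
Qed.

Lemma admissible_from_sym Y Z :
  is_basis Y -> admissible_from Y Z -> admissible_from Z Y.
Proof.
move=> Yb YZ; elim: YZ Yb => [Y' Z' m Yb|Y' _|Y1 Y2 Y3 Y12 IH12 Y23 IH23 Yb].
- by apply: rt_step; exact: elementary_move_sym.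
- exact: rt_refl.
- apply: rt_trans (IH12 Yb); apply: IH23; exact: admissible_from_basis Y12.
Qed.

Lemma expands_admissible Y Z : expands Y Z -> admissible_from Y Z.
Proof.
elim=> [? ? [i YZ]|?|? B ? _ YB _ BZ].
- by apply: rt_step; exists i; left.
- exact: rt_refl.
- exact: rt_trans YB BZ.
Qed.

Lemma admissible_from_finite Y Z :
  finite_set Y -> admissible_from Y Z -> finite_set Z.
Proof.
move=> + YZ; elim: YZ => // [Y' Z' [i [[y _ ->]|[a [_ _ ->]]]] fY|]; last by auto.
- by rewrite finite_setU; split; [exact: finite_setD | exact: finite_image].
- by rewrite finite_setU; split; [exact: finite_setD | exact: finite_set1].
Qed.

Lemma subset_descendants Y : Y `<=` descendants Y.
Proof. by move=> y Yy; exists y => //; exists [::]. Qed.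

Lemma expands_descendants Y Z D :
  expands Y Z -> Y `<=` descendants D -> Z `<=` descendants D.
Proof.
elim=> {Y Z} [Y Z [i [y Yy ->]] YD|//|? ? ? _ IH1 _ IH2 YD]; last by auto.
move=> u [[Yu _]|[j _ <-]]; first exact: YD.
have [z Dz [w _ <-]] := YD _ Yy.
by exists z => //; exists (rcons w (Tagged _ j)) => //; rewrite wact_rcons.
Qed.

Lemma ncard_expansion Y P p i : is_basis Y -> finite_set P -> P `<=` Y -> P p ->
  ncard ((P `\ p) `|` range (fun j => alp i j p)) = ncard P + (n i).-1.
Proof.
move=> Yb fP PY Pp; rewrite (ncardD1 fP Pp) ncardU.
- rewrite ncard_range ?addSnnS ?prednK //; first exact: ltnW.
  exact: basis_alp_inj Yb (PY _ Pp).
- exact: finite_setD.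
- exact: finite_image.
- apply/seteqP; split=> // u [[Pu up]] [j _ e]; apply: up.
  by apply/esym; apply: basis_notin_alp Yb _ _ e; exact: PY.
Qed.

(* An element of an expansion of [Y] descends from a unique element of [Y],  *)
(* and a simple expansion at [z] adds [n i - 1] descendants of [P] if [z] is *)
(* itself one, and none otherwise.                                           *)
Lemma expands_ncard Y Z P : is_basis Y -> finite_set Y -> P `<=` Y -> expands Y Z ->
  (ncard (Z `&` descendants P) = ncard P %[mod gcd_arities n]) /\
  (Z `&` descendants P !=set0 <-> P !=set0).
Proof.
move=> Yb fY PY YZ; set D := descendants P.
(* The ancestor in [Y] is unique, so a child descends from [P] exactly when its parent does. *)
have Dalp i j z : descendants Y z -> D (alp i j z) <-> D z.
  move=> [y Yy [w _ <-]]; split=> -[y' Py' [w' _ e]]; last first.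
    by exists y' => //; exists (rcons w' (Tagged _ j)) => //; rewrite wact_rcons e.
  have <- : y' = y.
    apply: (@basis_wact_inj Y y' y w' (rcons w (Tagged _ j))) => //; first exact: PY.
    by rewrite e wact_rcons.
  by exists y' => //; exists w.
have YD : Y `&` D = P.
  apply/seteqP; split=> [y [Yy [y' Py' [w _ e]]]|y Py].
    by rewrite -(@basis_wact_inj Y y' y w [::]) //; exact: PY.
  by split; [exact: PY | exact: subset_descendants].
(* Intermediate sets of the induction are no longer [Y]; what survives is that their elements
   descend from [Y]. *)
suff step B C : expands B C -> is_basis B -> finite_set B ->
    B `<=` descendants Y ->
    (ncard (C `&` D) = ncard (B `&` D) %[mod gcd_arities n]) /\
    (C `&` D !=set0 <-> B `&` D !=set0).
  by rewrite -YD; apply: step YZ Yb fY _; exact: subset_descendants.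
elim=> {B C} [B C [i [z Bz ->]]|B|B C E BC IH1 CE IH2] Bb fB sB.
- case: (pselect (D z)) => Dz; last first.
    have -> : (B `\ z `|` range (fun j => alp i j z)) `&` D = B `&` D.
      apply/seteqP; split=> u.
        by move=> [[[Bu _]|[j _ <-]]] // /(Dalp _ _ _ (sB _ Bz)).
      by move=> [Bu Du]; split=> //; left; split=> // uz; apply: Dz; rewrite -uz.
    by [].
  have -> : (B `\ z `|` range (fun j => alp i j z)) `&` D =
      (B `&` D) `\ z `|` range (fun j => alp i j z).
    apply/seteqP; split=> u.
      by move=> [[[Bu uz]|uz] Du]; [left | right].
    move=> [[[Bu Du] uz]|[j _ <-]]; first by split=> //; left.
    by split; [right; exists j | exact/(Dalp _ _ _ (sB _ Bz))].
  split.
    rewrite (@ncard_expansion B) //; last first.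
    - by apply: finite_setI; left.
    - have /dvdnP[k ->] : gcd_arities n %| (n i).-1.
        by rewrite /gcd_arities (bigD1 i) //= dvdn_gcdl.
      by rewrite addnC modnMDl.
  split=> _; first by exists z.
  exists (alp i (Ordinal (ltnW (arity_gt1 i))) z); right; by eexists.
- by [].
- have [c1 e1] := IH1 Bb fB sB.
  have BCa := expands_admissible BC.
  have [] := IH2 (admissible_from_basis Bb BCa) (admissible_from_finite fB BCa).
    exact: expands_descendants BC sB.
  by rewrite c1 e1.
Qed.

Definition alps i P : set A := [set alp i j u | u in P & j in @setT 'I_(n i)].

Lemma alps_setU1 i P u : alps i (u |` P) = range (fun j => alp i j u) `|` alps i P.
Proof.
apply/seteqP; split=> v.
  move=> [w [->|Pw] [j _ <-]]; first by left; exists j.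
  by right; exists w => //; exists j.
move=> [[j _ <-]|[w Pw [j _ <-]]]; first by exists u; [left | exists j].
by exists w; [right | exists j].
Qed.

(** No child of one element of [P] equals another element of [P], so expanding one by one never
    deletes children made earlier. *)
Lemma expands_alps i Y P : is_basis Y -> finite_set P -> P `<=` Y ->
  expands Y ((Y `\` P) `|` alps i P).
Proof.
move=> Yb; move: P; apply: finite_set_ind => [|u P _ Pu IH] PY.
  rewrite setD0 (_ : alps i set0 = set0) ?setU0; first exact: rt_refl.
  by apply/seteqP; split=> // ? [].
have Yu : Y u by apply: PY; left.
apply: rt_trans (IH _) _; first by move=> v Pv; apply: PY; right.
apply: rt_step; exists i, u; first by left.
rewrite alps_setU1; apply/seteqP; split=> v.
- move=> [[Yv Pv]|[|[w Pw [j _ <-]]]]; last 1 first.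
  + left; split; first by right; exists w => //; exists j.
    move=> e; apply: Pu; rewrite -(_ : w = u) //.
    by apply: basis_notin_alp Yb _ Yu e; apply: PY; right.
  + by left; split=> [|vu]; [left; split=> // Pv'; apply: Pv; right | apply: Pv; left].
  + by right.
- move=> [[[[Yv Pv]|]vu]|]; [left|by right; right|by right; left].
  by split=> // -[].
Qed.

Section Contract.
Variables (i : 'I_s) (Y : set A).
Hypothesis Yb : is_basis Y.

(** The condition for producing all of [P] at once by contractions using disjoint tuples of [Y]. *)
Definition contractible P : Prop := alps i P `<=` Y /\
  forall u v j k, P u -> P v -> alp i j u = alp i k v -> u = v /\ j = k.

(** An element of [P] inside the basis would equal all its children, whereas contractibility
    separates those of index 0 and 1. *)
Lemma contractible_notin P u : contractible P -> P u -> ~ Y u.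
Proof.
move=> [PY Pinj] Pu Yu.
have Yj j : alp i j u = u.
  by apply/esym; apply: basis_notin_alp Yb Yu _ erefl; apply: PY; exists u => //; exists j.
have [_] := Pinj u u (Ordinal (ltnW (arity_gt1 i))) (Ordinal (arity_gt1 i)) Pu Pu
  (etrans (Yj _) (esym (Yj _))).
by case.
Qed.

Lemma admissible_from_contract P : finite_set P -> contractible P ->
  admissible_from Y ((Y `\` alps i P) `|` P).
Proof.
move: P; apply: finite_set_ind => [|u P _ Pu IH] cP.
  rewrite (_ : alps i set0 = set0) ?setU0 ?setD0; first exact: rt_refl.
  by apply/seteqP; split=> // ? [].
have nY := contractible_notin cP; have [cPY cPI] := cP.
rewrite alps_setU1 in cPY *.
apply: rt_trans (IH _) _.
  split=> [v Pv|v w j k Pv Pw]; first by apply: cPY; right.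
  by apply: cPI; right.
apply: rt_step; exists i; right; exists (fun j => alp i j u); split.
- by move=> j k /cPI; case; try by left.
- move=> _ [j _ <-]; left; split; first by apply: cPY; left; exists j.
  move=> [w Pw [k _ e]]; apply: Pu; rewrite -(_ : w = u) //.
  by have [] := cPI _ _ _ _ _ _ e; [right | left |].
rewrite lam_alpK; apply/seteqP; split=> v.
- move=> [[Yv nv]|[->|Pv]]; [|by right|]; left.
    by split=> [|uv]; [left; split=> // Pv; apply: nv; right | apply: nv; left].
  split; first by right.
  by move=> uv; apply: (nY v); [right | apply: cPY; left].
- move=> [[[[Yv nv]|Pv] uv]|->]; [left|by right; right|by right; left].
  by split=> // -[].
Qed.

Lemma contractK P : contractible P ->
  (((Y `\` alps i P) `|` P) `\` P) `|` alps i P = Y.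
Proof.
move=> cP; apply/seteqP; split=> v.
  by move=> [[[[]|]//]|/(cP.1 v)].
move=> Yv; case: (pselect (alps i P v)) => nv; [by right | left; split].
  by left.
by move=> /(contractible_notin cP).
Qed.

End Contract.

End Bases.

(** * The Cantor algebra: freeness on its generators and nontriviality *)

Section CantorFree.
Variables (s : nat) (n : 'I_s -> nat) (S2 : sigma2 n) (X : finType).
Let U := cantor S2 X.
Let q : free_alg n X -> U := @to_cantor s n S2 X.

Lemma to_cantor_eq t u : q t = q u <-> sigma_cong S2 t u.
Proof.
split=> [/eqmodP /= /asboolP //|tu]; apply/eqmodP => /=; exact/asboolP.
Qed.

Lemma to_cantor_repr (u : U) : q (repr (u : cantor_carrier S2 X)) = u.
Proof. exact: reprK. Qed.

Lemma to_cantor_lam i a : q (Lam i a) = lam i (fun j => q (a j)).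
Proof.
apply/to_cantor_eq/SC_lam => j; apply/to_cantor_eq.
by rewrite to_cantor_repr.
Qed.

Lemma to_cantor_alp i j u : q (Alp i j u) = alp i j (q u).
Proof. by apply/to_cantor_eq/SC_alp/to_cantor_eq; rewrite to_cantor_repr. Qed.

Lemma cantor_lam_alpK i (u : U) : lam i (fun j => alp i j u) = u.
Proof.
rewrite -(to_cantor_repr u); under eq_fun do rewrite -to_cantor_alp.
by rewrite -to_cantor_lam; apply/to_cantor_eq/SC_alp_lam.
Qed.

Lemma cantor_alp_lamK i (a : 'I_(n i) -> U) j : alp i j (lam i a) = a j.
Proof.
pose b k : free_alg n X := repr (a k : cantor_carrier S2 X).
have -> : a = fun k => q (b k) by apply/funext => k; rewrite to_cantor_repr.
by rewrite -to_cantor_lam -to_cantor_alp; apply/to_cantor_eq/SC_lam_alp.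
Qed.

Definition cantor_gens : set U := range (fun x => q (Gen x)).

(** Full invariance of the congruence ([SC_subst]) lets substitution of terms descend to the
    quotient. *)
Lemma cantor_gens_basis : is_basis cantor_gens.
Proof.
split=> [h|f g [fl fa] [gl ga] fg].
  pose k x : term n X := repr (h (q (Gen x)) : cantor_carrier S2 X).
  pose f (u : U) : U := q (subst k (repr (u : cantor_carrier S2 X))).
  have fq t : f (q t) = q (subst k t).
    by apply/to_cantor_eq/SC_subst/to_cantor_eq; rewrite to_cantor_repr.
  exists f; last by move=> _ [x _ <-]; rewrite fq /= to_cantor_repr.
  split=> [i a|i j u]; last first.
    by rewrite -(to_cantor_repr u) -to_cantor_alp !fq /= to_cantor_alp.
  pose b j : free_alg n X := repr (a j : cantor_carrier S2 X).
  have -> : a = fun j => q (b j) by apply/funext => j; rewrite to_cantor_repr.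
  rewrite -to_cantor_lam fq /= to_cantor_lam.
  by apply: (congr1 (@lam s n U i)); apply/funext => j; rewrite fq.
move=> u; rewrite -(to_cantor_repr u); elim: (repr _) => [x|i a IH|i j t IH].
- by apply: fg; exists x.
- by rewrite to_cantor_lam fl gl; apply: (congr1 (@lam s n U i)); apply/funext.
- by rewrite to_cantor_alp fa ga IH.
Qed.

Lemma finite_cantor_gens : finite_set cantor_gens.
Proof. exact: finite_image. Qed.

(** Validity enters here: expanding a generator gives an admissible set with two distinct terms,
    whose image in a trivial algebra would be one point. *)
Lemma valid_nontrivial : 0 < s -> (forall i, 1 < n i) -> 0 < #|X| ->
  valid S2 X -> exists u v : U, u <> v.
Proof.
move=> s0 n1 /card_gt0P[x _] vX; apply: contrapT => triv.
have {}triv (u v : U) : u = v by apply: contrapT => uv; apply: triv; exists u, v.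
pose i : 'I_s := Ordinal s0.
pose Z : set (free_alg n X) := (range Gen `\ Gen x) `|` range (fun j => @Alp s n X i j (Gen x)).
have Zadm : free_admissible Z.
  by apply: rt_step; exists i; left; exists (Gen x) => //; exists x.
pose j0 : 'I_(n i) := Ordinal (ltnW (n1 i)); pose j1 : 'I_(n i) := Ordinal (n1 i).
have /card_bijP[f [g fK _]] := vX _ Zadm.
have Zj j : Alp i j (Gen x) \in Z by rewrite inE; right; exists j.
have : SigSub (Zj j0) = SigSub (Zj j1).
  by apply: (can_inj fK); apply: val_inj; exact: triv.
by move=> /(congr1 val)/= [].
Qed.

End CantorFree.

(** * Finite groups acting on sets *)

Section Actions.
Variables (G : groupType) (Q : set G).
Hypothesis Q_group : group_closed (mem Q).

Lemma group_closed1 : Q 1%g.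
Proof. by have [+ _] := Q_group; rewrite inE. Qed.

Lemma group_closed_inv q : Q q -> Q (q^-1)%g.
Proof. by move=> Qq; apply/set_mem; apply: (group_closedV Q_group); rewrite inE. Qed.

Lemma group_closed_mul p q : Q p -> Q q -> Q (p * q)%g.
Proof.
by move=> Qp Qq; apply/set_mem; apply: (group_closedM Q_group); rewrite inE.
Qed.

Let Q1 := group_closed1.
Let QV := group_closed_inv.
Let QM := group_closed_mul.

Definition is_action (U : Type) (rho : G -> U -> U) : Prop :=
  (forall u, rho 1%g u = u) /\
  forall p q u, Q p -> Q q -> rho (p * q)%g u = rho q (rho p u).

Definition trans_act (T : trans_set Q) (q : G) (x : T) : T := ts_act x q.

Lemma trans_actP T : is_action (@trans_act T).
Proof. by split=> *; rewrite /trans_act ?ts_act1 ?ts_actM. Qed.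

(** Equality of stabilizers in [Q]: exactly what makes sending [u] to [v] extend to an isomorphism
    of orbits ([same_stab_eq]). *)
Definition same_stab U V (rho : G -> U -> U) (sigma : G -> V -> V) u v : Prop :=
  forall q, Q q -> rho q u = u <-> sigma q v = v.

Definition act_stable U (rho : G -> U -> U) (Y : set U) : Prop :=
  forall q y, Q q -> Y y -> Y (rho q y).

Section OneAction.
Variables (U : Type) (rho : G -> U -> U).
Hypothesis rho_act : is_action rho.

Lemma actK q u : Q q -> rho (q^-1)%g (rho q u) = u.
Proof. by move=> Qq; rewrite -rho_act.2 ?mulgV ?rho_act.1 //; exact: QV. Qed.

Lemma actKV q u : Q q -> rho q (rho (q^-1)%g u) = u.
Proof. by move=> Qq; rewrite -rho_act.2 ?mulVg ?rho_act.1 //; exact: QV. Qed.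

Lemma act_eq p q u : Q p -> Q q -> rho p u = rho q u <-> rho (p * q^-1)%g u = u.
Proof.
move=> Qp Qq; rewrite rho_act.2 //; last exact: QV.
split=> [->|e]; first exact: actK.
by rewrite -(actKV (rho p u) Qq) e.
Qed.

Definition orb y : set U := [set rho q y | q in Q].

Lemma orb_refl y : orb y y.
Proof. by exists 1%g; rewrite ?rho_act.1. Qed.

Lemma orb_act q y : Q q -> orb (rho q y) = orb y.
Proof.
move=> Qq; apply/seteqP; split=> _ [p Qp <-].
  by exists (q * p)%g; rewrite ?rho_act.2 //; exact: QM.
exists (q^-1 * p)%g; first by apply: QM => //; exact: QV.
by rewrite rho_act.2 ?actK //; exact: QV.
Qed.

Lemma orb_eq y z : orb y = orb z -> exists2 q, Q q & rho q y = z.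
Proof. by move=> e; have : orb y z by rewrite e; exact: orb_refl. Qed.

Definition orbit_reps (M Y : set U) : Prop :=
  [/\ M `<=` Y, forall y, Y y -> exists2 q, Q q & M (rho q y) &
    forall m q, M m -> Q q -> M (rho q m) -> rho q m = m].

Lemma orbit_reps_exists Y : act_stable rho Y -> exists M, orbit_reps M Y.
Proof.
move=> Yi; case: (pselect (Y !=set0)) => [[y0 _]|Y0]; last first.
  exists set0; split=> // y Yy; by case: Y0; exists y.
(* A point is chosen for each set [O], not for each element, so that equal orbits get equal
   representatives. *)
have [f fP] : {f : set U -> U & forall O, O !=set0 -> O (f O)}.
  apply: (@choice _ _ (fun O y => O !=set0 -> O y)) => O.
  by case: (pselect (O !=set0)) => [[y Oy]|?]; [exists y | exists y0].
have forb y : orb y (f (orb y)) by apply: fP; exists y; exact: orb_refl.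
exists [set f (orb y) | y in Y]; split.
- by move=> _ [y Yy <-]; have [q Qq <-] := forb y; exact: Yi.
- move=> y Yy; have [q Qq e] := forb y; exists q => //; exists y => //.
- have forbE y : orb (f (orb y)) = orb y by have [q Qq <-] := forb y; exact: orb_act.
  move=> _ q [y Yy <-] Qq [z Zz e]; rewrite -e; congr f.
  by move: (congr1 orb e); rewrite orb_act // !forbE.
Qed.

Lemma orbit_reps_orb_inj M Y m m' :
  orbit_reps M Y -> M m -> M m' -> orb m = orb m' -> m = m'.
Proof. by move=> [_ _ MI] Mm Mm' /orb_eq[q Qq e]; rewrite -e MI // e. Qed.

Definition orbit_count (K Y : set U) : nat := ncard [set orb y | y in Y `&` K].

Lemma orbit_count_orbit_reps M Y K :
  act_stable rho K -> orbit_reps M Y -> orbit_count K Y = ncard (M `&` K).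
Proof.
move=> Ki MY; rewrite /orbit_count -(@ncard_image _ _ orb); last first.
  move=> m m' /set_mem[Mm _] /set_mem[Mm' _]; exact: orbit_reps_orb_inj MY _ _.
congr ncard; have [MsY YM MI] := MY; apply/seteqP; split=> _ [y [Yy Ky] <-].
  have [q Qq Mq] := YM y Yy; exists (rho q y); last exact: orb_act.
  by split=> //; exact: Ki.
by exists y => //; split=> //; exact: MsY.
Qed.

(* A transitive set is determined up to isomorphism by one point stabilizer, *)
(* so [typed T] is the union of the orbits of type [T].                      *)
Definition typed (T : trans_set Q) : set U :=
  [set y | exists x : T, same_stab rho (@trans_act T) y x].

End OneAction.

Lemma same_stab_act U V (rho : G -> U -> U) (sigma : G -> V -> V) u v q :
  is_action rho -> is_action sigma -> Q q ->
  same_stab rho sigma u v -> same_stab rho sigma (rho q u) (sigma q v).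
Proof.
move=> ra sa Qq uv p Qp.
rewrite -ra.2 // -sa.2 // !act_eq //; try exact: QM.
by apply: uv; do ?apply: QM => //; exact: QV.
Qed.

Lemma same_stab_eq U V (rho : G -> U -> U) (sigma : G -> V -> V) u v p q :
  is_action rho -> is_action sigma -> Q p -> Q q ->
  same_stab rho sigma u v -> rho p u = rho q u <-> sigma p v = sigma q v.
Proof.
move=> ra sa Qp Qq uv; rewrite !act_eq //; apply: uv.
by apply: QM => //; exact: QV.
Qed.

Lemma same_stab_sym U V (rho : G -> U -> U) (sigma : G -> V -> V) u v :
  same_stab rho sigma u v -> same_stab sigma rho v u.
Proof. by move=> uv q Qq; split=> /uv; apply. Qed.

Lemma same_stab_trans U V W (rho : G -> U -> U) (sigma : G -> V -> V)
  (tau : G -> W -> W) u v w :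
  same_stab rho sigma u v -> same_stab sigma tau v w -> same_stab rho tau u w.
Proof. by move=> uv vw q Qq; rewrite uv // vw. Qed.

Lemma trans_act_transitive (T : trans_set Q) (x y : T) :
  exists2 q, Q q & trans_act q x = y.
Proof.
have [z zT] := ts_trans T; have [p Qp <-] := zT x; have [q Qq <-] := zT y.
exists (p^-1 * q)%g; first by apply: QM => //; exact: QV.
rewrite (trans_actP T).2 //; last exact: QV.
by rewrite -[ts_act z p]/(trans_act p z) actK //; exact: trans_actP.
Qed.

(** Isomorphism of transitive sets, expressed by a common point stabilizer. *)
Definition trans_iso (T T' : trans_set Q) : Prop :=
  exists (x : T) (x' : T'), same_stab (@trans_act T) (@trans_act T') x x'.

Lemma typed_stable U (rho : G -> U -> U) T :
  is_action rho -> act_stable rho (typed rho T).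
Proof.
move=> ra q y Qq [x yx]; exists (trans_act q x).
by apply: same_stab_act => //; exact: trans_actP.
Qed.

Lemma typed_iso U (rho : G -> U -> U) T T' y :
  typed rho T y -> typed rho T' y -> trans_iso T T'.
Proof.
move=> [x yx] [x' yx']; exists x, x'.
exact: same_stab_trans (same_stab_sym yx) yx'.
Qed.

Lemma trans_iso_sym T T' : trans_iso T T' -> trans_iso T' T.
Proof. by move=> [x [x' xx']]; exists x', x; exact: same_stab_sym. Qed.

Lemma typed_eq U (rho : G -> U -> U) T T' :
  trans_iso T T' -> typed rho T = typed rho T'.
Proof.
suff sub S S' : trans_iso S S' -> typed rho S `<=` typed rho S'.
  by move=> TT'; apply/seteqP; split; apply: sub => //; exact: trans_iso_sym.
move=> [x [x' xx']] y [z yz]; have [q Qq qx] := trans_act_transitive x z.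
exists (trans_act q x'); apply: same_stab_trans yz _; rewrite -qx.
by apply: same_stab_act => //; exact: trans_actP.
Qed.

Section OrbitType.
Variables (U : Type) (rho : G -> U -> U) (y : U).
Hypothesis rho_act : is_action rho.
Variable l : seq {classic U}.
Hypothesis lE : orb rho y = [set` l].

(** A [trans_set] needs an action function on all of [G]; if the image leaves the orbit, [insubd]
    keeps the point fixed. *)
Definition orbit_act (x : seq_sub l) (q : G) : seq_sub l :=
  insubd x (rho q (val x) : {classic U}).

Lemma val_orbit_act x q : Q q -> val (orbit_act x q) = rho q (val x).
Proof.
move=> Qq; rewrite /orbit_act val_insubd.
have : orb rho y (val x) by rewrite lE; exact: valP.
move=> [p Qp e]; have : orb rho y (rho q (val x)).
  by rewrite -e -rho_act.2 //; exists (p * q)%g => //; exact: QM.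
by rewrite lE /= => ->.
Qed.

Lemma orbit_act1 x : orbit_act x 1%g = x.
Proof. by apply: val_inj; rewrite val_orbit_act // rho_act.1. Qed.

Lemma orbit_actM x p q : Q p -> Q q ->
  orbit_act x (p * q)%g = orbit_act (orbit_act x p) q.
Proof.
move=> Qp Qq; apply: val_inj; rewrite !val_orbit_act //; last exact: QM.
by rewrite rho_act.2.
Qed.

Lemma orbit_base : (y : {classic U}) \in l.
Proof. by have := orb_refl rho_act y; rewrite lE. Qed.

Lemma orbit_trans : exists x, forall z, exists2 q, Q q & orbit_act x q = z.
Proof.
exists (SeqSub orbit_base) => z.
have : orb rho y (val z) by rewrite lE; exact: valP.
by move=> [q Qq e]; exists q => //; apply: val_inj; rewrite val_orbit_act.
Qed.

Definition orbit_trans_set : trans_set Q :=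
  TransSet orbit_act1 orbit_actM orbit_trans.

Lemma typed_orbit_trans_set : typed rho orbit_trans_set y.
Proof.
exists (SeqSub orbit_base : orbit_trans_set) => q Qq; split=> e.
  by apply: val_inj; rewrite [LHS]val_orbit_act //; exact: e.
by have := congr1 val e; rewrite [in X in X -> _]val_orbit_act.
Qed.

End OrbitType.

Lemma typed_exists U (rho : G -> U -> U) y : is_action rho -> finite_set Q ->
  exists T, typed rho T y.
Proof.
move=> ra fQ; have : finite_set (orb rho y : set {classic U}) by exact: finite_image.
move=> /finite_seqP[l lE]; exists (orbit_trans_set ra lE).
exact: typed_orbit_trans_set.
Qed.

End Actions.

(** * Finite sets with equal orbit counts are equivariantly isomorphic *)

Lemma set_bij_of_rel (U V : Type) (v0 : V) (R : U -> V -> Prop) (Y : set U) (Z : set V) :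
  (forall y, Y y -> exists2 z, Z z & R y z) ->
  (forall z, Z z -> exists2 y, Y y & R y z) ->
  (forall y y' z z', R y z -> R y' z' -> y = y' <-> z = z') ->
  exists b, set_bij Y Z b /\ forall y, Y y -> R y (b y).
Proof.
move=> RY RZ RI.
have /choice[b bP] : forall y, exists z, Y y -> Z z /\ R y z.
  move=> y; case: (pselect (Y y)) => [/RY[z Zz yz]|?]; last by exists v0.
  by exists z.
exists b; split; last by move=> y /bP[].
split.
- by move=> y /bP[].
- by move=> y y' /set_mem/bP[_ Ry] /set_mem/bP[_ Ry'] /(RI _ _ _ _ Ry Ry').
- move=> z Zz; have [y Yy yz] := RZ z Zz; exists y => //.
  by apply/(RI _ _ _ _ (bP _ Yy).2 yz).
Qed.

Section EquivariantBijection.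
Variables (G : groupType) (Q : set G) (U V : Type).
Variables (rho : G -> U -> U) (sigma : G -> V -> V) (Y : set U) (Z : set V) (v0 : V).
Hypothesis Q_group : group_closed (mem Q).
Hypothesis Q_fin : finite_set Q.
Hypothesis rho_act : is_action Q rho.
Hypothesis sigma_act : is_action Q sigma.
Hypothesis Y_inv : act_stable Q rho Y.
Hypothesis Z_inv : act_stable Q sigma Z.
Hypothesis Y_fin : finite_set Y.
Hypothesis Z_fin : finite_set Z.
Hypothesis count_eq : forall T : trans_set Q,
  orbit_count Q rho (typed rho T) Y = orbit_count Q sigma (typed sigma T) Z.

Lemma typed_bij M N (T : trans_set Q) : orbit_reps Q rho M Y -> orbit_reps Q sigma N Z ->
  exists f, set_bij (M `&` typed rho T) (N `&` typed sigma T) f.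
Proof.
move=> MY NZ; have [MsY _ _] := MY; have [NsZ _ _] := NZ.
apply: card_eq_set_bij => //.
have fM : finite_set (M `&` typed rho T).
  by apply: finite_setIl; exact: sub_finite_set Y_fin.
have fN : finite_set (N `&` typed sigma T).
  by apply: finite_setIl; exact: sub_finite_set Z_fin.
rewrite (card_eql (ncardP fM)) (card_eqr (ncardP fN)); apply/card_eq_II.
rewrite -(orbit_count_orbit_reps _ _ _ MY) // ?count_eq; last first.
  exact: typed_stable.
by rewrite -(orbit_count_orbit_reps _ _ _ NZ) //; exact: typed_stable.
Qed.

Lemma orbit_reps_match M N : orbit_reps Q rho M Y -> orbit_reps Q sigma N Z ->
  exists beta, set_bij M N beta /\
    forall m, M m -> exists2 T : trans_set Q, typed rho T m & typed sigma T (beta m).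
Proof.
move=> MY NZ.
have [f fP] := choice (fun T : trans_set Q => typed_bij T MY NZ).
have /choice[c cP] : forall K : set U, exists S : trans_set Q,
    forall T : trans_set Q, typed rho T = K -> typed rho S = K.
  move=> K.
  case: (pselect (exists T : trans_set Q, typed rho T = K)) => [[T TK]|nK]; first by exists T.
  have [T _] := typed_exists Q_group v0 sigma_act Q_fin.
  by exists T => S SK; case: nK; exists S.
have [t tP] := choice (fun m => typed_exists Q_group m rho_act Q_fin).
(* [tau m] is a representative of the type of the orbit of [m] that depends  *)
(* only on that type, so that the bijections [f T] can be glued.             *)
pose tau m := c (typed rho (t m)).
have tauE m : typed rho (tau m) = typed rho (t m) by apply: cP.
have tauP m : typed rho (tau m) m by rewrite tauE.
have tau_eq m m' : typed rho (tau m) m' -> tau m = tau m'.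
  move=> mm'; congr c; rewrite -!tauE; apply: typed_eq => //.
  exact: typed_iso mm' (tauP m').
pose beta m := f (tau m) m.
have betaP m : M m -> N (beta m) /\ typed sigma (tau m) (beta m).
  by move=> Mm; have [fh _ _] := fP (tau m); apply: fh.
exists beta; split; last by move=> m Mm; exists (tau m); [|exact: (betaP m Mm).2].
split.
- by move=> m /betaP[].
- move=> m m' /set_mem Mm /set_mem Mm' e.
  have mm' : tau m = tau m'.
    have := (betaP m' Mm').2; rewrite -e => /(typed_iso (betaP m Mm).2) iso.
    by apply: tau_eq; rewrite (typed_eq Q_group rho iso).
  have [_ finj _] := fP (tau m); apply: finj; rewrite ?inE //.
    by split=> //; rewrite mm'.
  by rewrite -/(beta m) e /beta mm'.
- move=> z Nz; have [T zT] := typed_exists Q_group z sigma_act Q_fin.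
  have [_ _ /(_ z (conj Nz zT)) [m [Mm mT] _]] := fP T.
  have iso : trans_iso T (tau m) by exact: typed_iso mT (tauP m).
  have [_ _ fsurj] := fP (tau m).
  have [|m1 [Mm1 m1T] e] := fsurj z.
    by split=> //; rewrite -(typed_eq Q_group sigma iso).
  by exists m1 => //; rewrite /beta -(tau_eq m m1).
Qed.

(** Matched representatives [m] and [beta m] have isomorphic orbits but possibly only conjugate
    stabilizers. Replacing [beta m] by a translate [g m] with the stabilizer of [m] makes the map
    from [rho q m] to [sigma q (g m)] well defined and injective. *)
Lemma equivariant_bijection : exists b, set_bij Y Z b /\
  forall q y, Q q -> Y y -> b (rho q y) = sigma q (b y).
Proof.
have [M MY] := orbit_reps_exists Q_group rho_act Y_inv.
have [N NZ] := orbit_reps_exists Q_group sigma_act Z_inv.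
have [beta [[betaN betaI betaS] betaT]] := orbit_reps_match MY NZ.
have [MsY YM MI] := MY; have [NsZ ZN NI] := NZ.
have /choice[g gP] : forall m, exists z, M m ->
    same_stab Q rho sigma m z /\ exists2 q, Q q & z = sigma q (beta m).
  move=> m; case: (pselect (M m)) => [Mm|?]; last by exists v0.
  have [T [x mx] [x' bx']] := betaT m Mm.
  have [q Qq e] := trans_act_transitive Q_group x' x.
  exists (sigma q (beta m)) => _; split; last by exists q.
  apply: same_stab_trans mx _; apply: same_stab_sym; rewrite -e.
  by apply: same_stab_act => //; exact: trans_actP.
pose R y z := exists m q, [/\ M m, Q q, y = rho q m & z = sigma q (g m)].
have [] := @set_bij_of_rel U V v0 R Y Z.
- move=> y Yy; have [q Qq Mq] := YM y Yy; have Qq' := group_closed_inv Q_group Qq.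
  exists (sigma (q^-1)%g (g (rho q y))).
    apply: Z_inv => //; have [_ [r Qr ->]] := gP _ Mq.
    by apply: Z_inv => //; apply: NsZ; exact: betaN.
  by exists (rho q y), (q^-1)%g; rewrite (actK Q_group rho_act).
- move=> z Zz; have [q Qq Nq] := ZN z Zz; have [m Mm em] := betaS _ Nq.
  have [_ [r Qr er]] := gP m Mm.
  have Qp : Q ((q * r)^-1)%g by apply: (group_closed_inv Q_group); apply: group_closed_mul.
  exists (rho ((q * r)^-1)%g m); first by apply: Y_inv => //; exact: MsY.
  exists m, ((q * r)^-1)%g; split=> //.
  by rewrite er em -(sigma_act.2 q r) // (actK Q_group sigma_act) //; exact: group_closed_mul.
- move=> _ _ _ _ [m [q [Mm Qq -> ->]]] [m' [q' [Mm' Qq' -> ->]]].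
  have mm' : orb Q rho m = orb Q rho m' \/ orb Q sigma (beta m) = orb Q sigma (beta m') ->
      m = m'.
    case; first exact: (orbit_reps_orb_inj Q_group rho_act MY).
    move=> e; apply: betaI; rewrite ?inE //.
    by apply: (orbit_reps_orb_inj Q_group sigma_act NZ) e; exact: betaN.
  split=> e.
    have E : m = m'.
      by apply: mm'; left; rewrite -(orb_act Q_group rho_act m Qq) e (orb_act Q_group rho_act).
    by rewrite -E in e *; apply/(same_stab_eq Q_group rho_act sigma_act Qq Qq' (gP m Mm).1).
  have E : m = m'.
    apply: mm'; right; move: (congr1 (orb Q sigma) e).
    have [_ [r Qr ->]] := gP m Mm; have [_ [r' Qr' ->]] := gP m' Mm'.
    by rewrite !(orb_act Q_group sigma_act).
  by rewrite -E in e *; apply/(same_stab_eq Q_group rho_act sigma_act Qq Qq' (gP m Mm).1).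
move=> b [bij bR]; exists b; split=> // q y Qq Yy.
have [m [p [Mm Qp ey ez]]] := bR y Yy.
have [m' [p' [Mm' Qp' ey' ez']]] := bR _ (Y_inv Qq Yy).
rewrite ez' ez -sigma_act.2 //.
have E : m = m'.
  apply: (orbit_reps_orb_inj Q_group rho_act MY) => //.
  by rewrite -(orb_act Q_group rho_act m' Qp') -ey' !(orb_act Q_group rho_act) // ey
    (orb_act Q_group rho_act).
rewrite -E in ey' *; apply/(same_stab_eq Q_group rho_act sigma_act _ _ (gP m Mm).1) => //.
  exact: group_closed_mul.
by rewrite -ey' ey rho_act.2.
Qed.

End EquivariantBijection.

(** * Fixed admissible sets *)

Section AutAction.
Variables (s : nat) (n : 'I_s -> nat) (A : omega_alg n).
Implicit Types (g h : omega_aut A) (Y Z : set A).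

Lemma aut_inj g : injective g.
Proof. exact: can_inj (@aut_funK _ _ _ g). Qed.

Lemma aut_endo g : is_endo g.
Proof. by split=> *; rewrite ?aut_lam ?aut_alp. Qed.

Lemma aut_mulE g h u : (g * h)%g u = h (g u). Proof. by []. Qed.

Lemma aut_invKV g u : g ((g^-1)%g u) = u. Proof. exact: aut_invK. Qed.

Lemma aut_invVK g u : (g^-1)%g (g u) = u. Proof. exact: aut_funK. Qed.

Lemma image_autM g h Y : (g * h)%g @` Y = h @` (g @` Y).
Proof. by rewrite image_comp. Qed.

Lemma image_autVK g Y : (g^-1)%g @` (g @` Y) = Y.
Proof. by rewrite -image_autM mulgV; exact: image_id. Qed.

Lemma image_autKV g Y : g @` ((g^-1)%g @` Y) = Y.
Proof. by rewrite -image_autM mulVg; exact: image_id. Qed.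

Lemma image_autD g Y Z : g @` (Y `\` Z) = g @` Y `\` g @` Z.
Proof.
apply/seteqP; split=> u.
  by move=> [y [Yy nZ] <-]; split=> [|[z Zz /aut_inj e]]; [exists y | apply: nZ; rewrite -e].
by move=> [[y Yy <-] nZ]; exists y => //; split=> // Zy; apply: nZ; exists y.
Qed.

Lemma image_aut_alp g i y :
  g @` range (fun j : 'I_(n i) => alp i j y) = range (fun j => alp i j (g y)).
Proof. by rewrite image_comp; apply: eq_imagel => j _ /=; rewrite aut_alp. Qed.

Lemma simple_expansion_aut g i Y Z :
  simple_expansion i Y Z -> simple_expansion i (g @` Y) (g @` Z).
Proof.
move=> [y Yy ->]; exists (g y); first by exists y.
by rewrite image_setU image_autD image_set1 image_aut_alp.
Qed.

Lemma simple_contraction_aut g i Y Z :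
  simple_contraction i Y Z -> simple_contraction i (g @` Y) (g @` Z).
Proof.
move=> [a [aI aY ->]]; exists (g \o a).
have -> : range (g \o a) = g @` range a by rewrite image_comp.
split; first by move=> j k /aut_inj/aI.
- exact: image_subset.
- by rewrite image_setU image_autD image_set1 aut_lam.
Qed.

Lemma expands_aut g Y Z : expands Y Z -> expands (g @` Y) (g @` Z).
Proof.
elim=> [? ? [i YZ]|?|? B ? _ YB _ BZ]; [|exact: rt_refl|exact: rt_trans YB BZ].
by apply: rt_step; exists i; exact: simple_expansion_aut.
Qed.

Lemma admissible_from_aut g Y Z :
  admissible_from Y Z -> admissible_from (g @` Y) (g @` Z).
Proof.
elim=> [? ? [i [] YZ]|?|? B ? _ YB _ BZ];
  [| |exact: rt_refl|exact: rt_trans YB BZ]; apply: rt_step; exists i.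
- by left; exact: simple_expansion_aut.
- by right; exact: simple_contraction_aut.
Qed.

End AutAction.

(** * Common expansions and least upper bounds *)

Section Poset.
Variables (s : nat) (n : 'I_s -> nat) (S2 : sigma2 n) (X : finType).
Let U := cantor S2 X.
Hypothesis arity_gt1 : forall i, 1 < n i.
Hypothesis U_nontrivial : exists u v : U, u <> v.
Hypothesis U_bounded : bounded S2 X.
Implicit Types (Y Z B C : set U) (g : omega_aut U).

Lemma admissible_basis Y : admissible Y -> is_basis Y.
Proof.
apply: admissible_from_basis.
- exact: cantor_lam_alpK.
- exact: cantor_alp_lamK.
- exact: cantor_gens_basis.
Qed.

Lemma admissible_finite Y : admissible Y -> finite_set Y.
Proof. exact/admissible_from_finite/finite_cantor_gens. Qed.

Lemma admissible_expands Y Z : admissible Y -> expands Y Z -> admissible Z.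
Proof. by move=> Ya /expands_admissible; exact: rt_trans. Qed.

Lemma admissible_connected Y Z : admissible Y -> admissible Z -> admissible_from Y Z.
Proof.
move=> Ya; apply: rt_trans; apply: admissible_from_sym => //.
- exact: cantor_lam_alpK.
- exact: cantor_alp_lamK.
- exact: cantor_gens_basis.
Qed.

(** If each expands to the other, both are least upper bounds of [Y] with itself, and that bound is
    unique. *)
Lemma expands_antisym Y Z : admissible Y -> admissible Z ->
  expands Y Z -> expands Z Y -> Y = Z.
Proof.
move=> Ya Za YZ ZY; have YY : expands Y Y by exact: rt_refl.
have [T [_ Tu]] := U_bounded Ya Ya Ya YY YY.
have lubP S : admissible S -> expands Y S -> expands S Y -> T = S.
  by move=> Sa YS SY; apply: Tu; split=> // R Ra YR _; exact: rt_trans SY YR.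
by rewrite -(lubP Y) // -(lubP Z).
Qed.

Lemma lub_exists B C D : admissible B -> admissible C -> admissible D ->
  expands B C -> expands B D -> exists T, is_lub C D T.
Proof.
by move=> Ba Ca Da BC BD; have [T [TP _]] := U_bounded Ba Ca Da BC BD; exists T.
Qed.

Lemma upper_bound_exists B C : admissible B -> admissible C ->
  exists T, [/\ admissible T, expands B T & expands C T].
Proof.
move=> Ba Ca; move/(admissible_connected Ba): (Ca) => BC.
elim: BC Ba {Ca} => {B C} [B C [i [BC|BC]]|B|B C D BC IH1 CD IH2] Ba.
- exists C; split; [|by apply: rt_step; exists i|exact: rt_refl].
  by apply: rt_trans Ba _; apply: rt_step; exists i; left.
- exists B; split; [by []|exact: rt_refl|apply: rt_step; exists i].
  apply: contraction_sym (admissible_basis Ba) BC => //.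
  exact: cantor_alp_lamK.
- by exists B; split=> //; exact: rt_refl.
- have Ca : admissible C by exact: rt_trans Ba BC.
  have [T1 [T1a BT1 CT1]] := IH1 Ba.
  have [T2 [T2a CT2 DT2]] := IH2 Ca.
  have [T [Ta T1T T2T _]] := lub_exists Ca T1a T2a CT1 CT2.
  by exists T; split=> //; [exact: rt_trans T1T|exact: rt_trans T2T].
Qed.

Lemma finite_upper_bound (F : set (set U)) B : finite_set F ->
  admissible B -> F `<=` @admissible _ _ S2 X ->
  exists T, [/\ admissible T, expands B T & forall C, F C -> expands C T].
Proof.
move=> + Ba; move: F; apply: finite_set_ind => [|C F _ _ IH] FA.
  by exists B; split=> //; exact: rt_refl.
have [|T [Ta BT FT]] := IH; first by move=> D FD; apply: FA; right.
have [|T' [T'a TT' CT']] := @upper_bound_exists T C Ta; first by apply: FA; left.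
exists T'; split=> //; first exact: rt_trans TT'.
by move=> D [-> //|/FT DT]; exact: rt_trans TT'.
Qed.

(** Boundedness speaks only of sets with a common lower bound, whence [B]. *)
Lemma finite_lub (F : set (set U)) B : finite_set F ->
  admissible B -> (forall C, F C -> admissible C /\ expands B C) ->
  exists T, [/\ admissible T, expands B T, forall C, F C -> expands C T &
    forall R, admissible R -> expands B R -> (forall C, F C -> expands C R) ->
      expands T R].
Proof.
move=> + Ba; move: F; apply: finite_set_ind => [|C F _ _ IH] FA.
  by exists B; split=> //; exact: rt_refl.
have [|T [Ta BT FT Tleast]] := IH; first by move=> D FD; apply: FA; right.
have [Ca BC] : admissible C /\ expands B C by apply: FA; left.
have [T' [T'a TT' CT' T'least]] := lub_exists Ba Ta Ca BT BC.
exists T'; split=> //; first exact: rt_trans TT'.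
  by move=> D [-> //|/FT DT]; exact: rt_trans TT'.
move=> R Ra BR FR; apply: T'least => //; last by apply: FR; left.
by apply: Tleast => // D FD; apply: FR; right.
Qed.

(** [g] carries moves from [V] to [Y] to moves from [W] to the image of [Y]. *)
Lemma Gr_admissible g Y : Gr S2 X g -> admissible Y -> admissible (g @` Y).
Proof.
move=> [V [W [Va Wa [gVW _ gS]]]] Ya.
have gV : g @` V = W by apply/seteqP; split=> // _ [v Vv <-]; exact: gVW.
apply: rt_trans Wa _; rewrite -gV; apply: admissible_from_aut.
exact: admissible_connected.
Qed.

(** * Admissible sets fixed by a finite subgroup *)

Section Fixed.
Variable Q : set (omega_aut U).
Hypothesis Q_sub : subgroup_of (Gr S2 X) Q.
Hypothesis Q_fin : finite_set Q.

Let Q_group : group_closed (mem Q). Proof. exact: proj2 Q_sub. Qed.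

Lemma subgroup_admissible g Y : Q g -> admissible Y -> admissible (g @` Y).
Proof. by move=> /Q_sub.1; exact: Gr_admissible. Qed.

(* All translates of [Z] lie above [B], so they have a least upper bound,    *)
(* which is fixed by [Q] because it is unique.                               *)
Lemma fixed_expansion B Z : admissible B -> admissible Z ->
  (forall g, Q g -> expands B (g @` Z)) ->
  exists2 T, fixed_admissible Q T & expands Z T.
Proof.
move=> Ba Za BZ; pose F : set (set U) := [set g @` Z | g in Q].
have [|||T [Ta BT FT Tleast]] := @finite_lub F B.
- exact: finite_image.
- exact: Ba.
- by move=> _ [g Qg <-]; split; [exact: subgroup_admissible|exact: BZ].
exists T; last by apply: FT; exists 1%g; [exact: (group_closed1 Q_group)|exact: image_id].
(* The image of [T] is again above all translates of [Z], so [T] expands to it; the inverse of [g]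
   gives the converse. *)
have gT g : Q g -> expands T (g @` T).
  move=> Qg; apply: Tleast; first exact: subgroup_admissible.
    by apply: rt_trans (BZ _ Qg) _; apply: expands_aut; apply: FT; exists 1%g;
      [exact: (group_closed1 Q_group)|exact: image_id].
  move=> _ [h Qh <-]; rewrite -(image_autKV g (h @` Z)); apply: expands_aut.
  rewrite -image_autM; apply: FT; exists (h * g^-1)%g => //.
  by apply: (group_closed_mul Q_group) => //; exact: (group_closed_inv Q_group).
split=> // g Qg; apply: expands_antisym; [exact: subgroup_admissible|by []| |exact: gT].
by rewrite -{2}(image_autKV g T); apply: expands_aut; apply: gT; exact: (group_closed_inv Q_group).
Qed.

(** Prepares [fixed_expansion]: a set above every translate of [B] has all its own translates above
    [B]. *)
Lemma upper_bound_translates B Z : admissible B -> admissible Z ->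
  exists T, [/\ admissible T, expands Z T & forall g, Q g -> expands B (g @` T)].
Proof.
move=> Ba Za; have [|||T [Ta ZT FT]] := @finite_upper_bound [set g @` B | g in Q] Z.
- exact: finite_image.
- exact: Za.
- by move=> _ [g Qg <-]; exact: subgroup_admissible.
exists T; split=> // g Qg; rewrite -(image_autKV g B); apply: expands_aut.
by apply: FT; exists (g^-1)%g => //; exact: (group_closed_inv Q_group).
Qed.

Lemma fixed_exists : exists Y, fixed_admissible Q Y.
Proof.
have Xa : admissible (@cantor_gens s n S2 X) by exact: rt_refl.
have [T [Ta _ XT]] := upper_bound_translates Xa Xa.
by have [Y Yf _] := fixed_expansion Xa Ta XT; exists Y.
Qed.

Lemma fixed_upper_bound Y Z : fixed_admissible Q Y -> fixed_admissible Q Z ->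
  exists T, [/\ fixed_admissible Q T, expands Y T & expands Z T].
Proof.
move=> [Ya Yq] [Za Zq].
have [T [Ta YT ZT]] := upper_bound_exists Ya Za.
have [|T' T'f TT'] := fixed_expansion Ya Ta.
  by move=> g Qg; rewrite -(Yq g Qg); exact: expands_aut.
by exists T'; split=> //; [exact: rt_trans TT'|exact: rt_trans TT'].
Qed.

End Fixed.
End Poset.

(** By Bezout some multiple of [k] is a multiple of [l] plus the gcd: go up by the first, down by
    the second. Arguments stay positive because, in the application, a type without orbits offers
    nothing to expand. *)
Lemma shift_gcdn (P : nat -> Prop) k l :
  (forall m, 0 < m -> P m <-> P (m + k)) ->
  (forall m, 0 < m -> P m <-> P (m + l)) ->
  forall m, 0 < m -> P m <-> P (m + gcdn k l).
Proof.
move=> Pk Pl m m0.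
have mul a b : (forall c, 0 < c -> P c <-> P (c + a)) ->
    forall c, 0 < c -> P c <-> P (c + b * a).
  move=> Pa; elim: b => [|b IH] c c0; first by rewrite mul0n addn0.
  by rewrite mulSn addnA; apply: iff_trans (Pa c c0) (IH _ _); rewrite ltn_addr.
have [->|k0] := posnP k; first by rewrite gcd0n; exact: Pl.
case: (egcdnP l k0) => u v e _.
apply: iff_trans (mul _ u Pk m m0) _; rewrite e addnA addnAC; apply: iff_sym.
by apply: mul => //; rewrite ltn_addr.
Qed.

(** * Orbit counts of fixed admissible sets *)

Section FixedCount.
Variables (s : nat) (n : 'I_s -> nat) (S2 : sigma2 n) (X : finType).
Let U := cantor S2 X.
Hypothesis s_gt0 : 0 < s.
Hypothesis arity_gt1 : forall i, 1 < n i.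
Hypothesis U_nontrivial : exists u v : U, u <> v.
Hypothesis U_bounded : bounded S2 X.
Variable Q : set (omega_aut U).
Hypothesis Q_sub : subgroup_of (Gr S2 X) Q.
Hypothesis Q_fin : finite_set Q.
Implicit Types (Y Z M : set U) (g q : omega_aut U) (T : trans_set Q).

Definition aut_act (A : omega_alg n) (g : omega_aut A) (u : A) : A := g u.

Lemma aut_actP : is_action Q (@aut_act U). Proof. by []. Qed.

Local Notation act := (@aut_act U).
Local Notation cnt T Y := (orbit_count Q act (typed act T) Y).

Let Q_group : group_closed (mem Q). Proof. exact: proj2 Q_sub. Qed.

Lemma cantor_wact_inj Y y y' w w' : admissible Y -> Y y -> Y y' ->
  wact y w = wact y' w' -> y = y'.
Proof.
move=> Ya; apply: basis_wact_inj (admissible_basis Ya) => //.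
exact: cantor_alp_lamK.
Qed.

Lemma fixed_admissibleP Y :
  fixed_admissible Q Y <-> admissible Y /\ act_stable Q act Y.
Proof.
split=> -[Ya Yq]; split=> //.
  by move=> q y Qq Yy; rewrite -(Yq q Qq); exists y.
move=> q Qq; apply/seteqP; split=> [_ [y Yy <-]|y Yy]; first exact: Yq.
exists (act q^-1%g y); last exact: aut_invKV.
by apply: Yq => //; exact: (group_closed_inv Q_group Qq).
Qed.

(** Automorphisms commute with descending words and ancestors in [Y] are unique, so [q] fixes a
    descendant only by fixing [y]. *)
Lemma wact_same_stab Y y w : fixed_admissible Q Y -> Y y ->
  same_stab Q act act y (wact y w).
Proof.
move=> /fixed_admissibleP[Ya Yq] Yy q Qq; rewrite /aut_act endo_wact; last exact: aut_endo.
split=> [->//|e]; exact: cantor_wact_inj Ya (Yq q y Qq Yy) Yy e.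
Qed.

Lemma typed_same_stab T y z : same_stab Q act act y z -> typed act T y <-> typed act T z.
Proof.
move=> yz; split=> -[x xs]; exists x; last exact: same_stab_trans yz xs.
by apply: same_stab_trans xs; exact: same_stab_sym.
Qed.

Lemma typed_wact T Y y w : fixed_admissible Q Y -> Y y ->
  typed act T (wact y w) <-> typed act T y.
Proof. by move=> Yf Yy; split=> /(typed_same_stab T (wact_same_stab w Yf Yy)). Qed.

Lemma typed_act_stable T : act_stable Q act (typed act T).
Proof. exact: (typed_stable Q_group aut_actP). Qed.

(** Ancestry is an equivariant map from [Z] to [Y] preserving stabilizers, so the preimage of a
    transversal is a transversal. *)
Lemma orbit_reps_expands M Y Z : fixed_admissible Q Y -> fixed_admissible Q Z ->
  expands Y Z -> orbit_reps Q act M Y -> orbit_reps Q act (Z `&` descendants M) Z.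
Proof.
move=> /[dup] Yf /fixed_admissibleP[Ya Yq] /fixed_admissibleP[Za Zq] YZ [MY YM MI].
have ZD := expands_descendants YZ (@subset_descendants _ _ _ Y).
split=> [z [] //|z Zz|z q [_ [y My [w _ <-]]] Qq [_ [y' My' [w' _ e]]]].
  have [y Yy [w _ e]] := ZD z Zz; have [q Qq Mq] := YM y Yy.
  exists q => //; split; first exact: Zq.
  by exists (q y) => //; exists w => //; rewrite -e /aut_act endo_wact //; exact: aut_endo.
rewrite /aut_act endo_wact in e *; last exact: aut_endo.
have qy : y' = q y by apply: cantor_wact_inj Ya _ _ e; [exact: MY | apply: Yq => //; exact: MY].
have {}qy : q y = y by apply: MI => //; rewrite /aut_act -qy.
by rewrite qy.
Qed.

Lemma fixed_reps Y : fixed_admissible Q Y -> exists M, orbit_reps Q act M Y.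
Proof. by move=> /fixed_admissibleP[_]; exact: (orbit_reps_exists Q_group aut_actP). Qed.

Lemma cnt_reps M Y T : orbit_reps Q act M Y -> cnt T Y = ncard (M `&` typed act T).
Proof.
exact: (orbit_count_orbit_reps Q_group aut_actP (@typed_act_stable T)).
Qed.

(** Restricting a transversal to type [T] commutes with taking descendants, so [expands_ncard]
    counts the orbits. *)
Lemma cnt_expands T Y Z : fixed_admissible Q Y -> fixed_admissible Q Z -> expands Y Z ->
  cnt T Z = cnt T Y %[mod gcd_arities n] /\ (cnt T Z = 0 <-> cnt T Y = 0).
Proof.
move=> Yf Zf YZ; have [M MY] := fixed_reps Yf; have [MsY _ _] := MY.
rewrite (cnt_reps _ (orbit_reps_expands Yf Zf YZ MY)) (cnt_reps _ MY).
have [[Ya _] [Za _]] := (Yf, Zf).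
have -> : Z `&` descendants M `&` typed act T = Z `&` descendants (M `&` typed act T).
  apply/seteqP; split=> u.
    move=> [[Zu [y My [w _ e]]]]; rewrite -e in Zu *; rewrite (typed_wact _ _ Yf); last exact: MsY.
    by move=> Ty; split=> //; exists y; [split | exists w].
  move=> [Zu [y [My Ty] [w _ e]]]; split; first by split=> //; exists y => //; exists w.
  by rewrite -e (typed_wact _ _ Yf) //; exact: MsY.
have PY : M `&` typed act T `<=` Y by move=> u [Mu _]; exact: MsY.
have [c e] := expands_ncard (@cantor_lam_alpK _ _ S2 X)
  (@cantor_alp_lamK _ _ S2 X) U_nontrivial arity_gt1
  (admissible_basis Ya) (admissible_finite Ya) PY YZ.
split=> //; rewrite !ncard_eq0P ?e //; first exact: sub_finite_set PY (admissible_finite Ya).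
by apply: finite_setIl; exact: admissible_finite.
Qed.

Lemma cnt_congr T Y Z : fixed_admissible Q Y -> fixed_admissible Q Z ->
  cnt T Z = cnt T Y %[mod gcd_arities n] /\ (cnt T Z = 0 <-> cnt T Y = 0).
Proof.
move=> Yf Zf; have [S [Sf YS ZS]] :=
  fixed_upper_bound arity_gt1 U_nontrivial U_bounded Q_sub Q_fin Yf Zf.
have [c1 e1] := cnt_expands T Yf Sf YS; have [c2 e2] := cnt_expands T Zf Sf ZS.
by split; [rewrite -c1 -c2 | rewrite -e1 -e2].
Qed.

Lemma gcd_arities_gt0 : 0 < gcd_arities n.
Proof.
rewrite /gcd_arities (bigD1 (Ordinal s_gt0)) //= gcdn_gt0.
by rewrite -subn1 subn_gt0 arity_gt1.
Qed.

(** In 0..d the residue modulo d confuses only 0 and d, and vanishing tells these apart. *)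
Lemma cnt_unique T Y Z : fixed_admissible Q Y -> fixed_admissible Q Z ->
  cnt T Y <= gcd_arities n -> cnt T Z <= gcd_arities n -> cnt T Y = cnt T Z.
Proof.
move=> Yf Zf; have [] := cnt_congr T Yf Zf.
move: (cnt T Y) (cnt T Z) gcd_arities_gt0 => y z; move: (gcd_arities n) => d d0.
have [->|y0] := posnP y; first by move=> _ [_ ->].
have [->|z0] := posnP z; first by move=> _ [-> //].
move=> + _; rewrite [y <= _]leq_eqVlt [z <= _]leq_eqVlt.
move=> e /orP[/eqP yd|yd] /orP[/eqP zd|zd]; move: e.
- by rewrite yd zd.
- by rewrite yd modnn modn_small // => e; rewrite e in z0.
- by rewrite zd modnn modn_small // => e; rewrite -e in y0.
- by rewrite !modn_small.
Qed.

Lemma cnt_gt0P T Y : fixed_admissible Q Y -> 0 < cnt T Y <-> exists2 y, Y y & typed act T y.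
Proof.
move=> Yf; have fO : finite_set [set orb Q act y | y in Y `&` typed act T].
  by apply: finite_image; apply: finite_setIl; exact: admissible_finite Yf.1.
rewrite lt0n; split=> [/eqP|[y Yy Ty]].
  rewrite /orbit_count ncard_eq0P // => /contrapT[_ [y [Yy Ty] _]]; by exists y.
by apply/eqP; rewrite /orbit_count ncard_eq0P //; apply; exists (orb Q act y), y.
Qed.

Lemma orb_stable y : act_stable Q act (orb Q act y).
Proof.
by move=> q _ Qq [p Qp <-]; exists (p * q)%g => //; exact: (group_closed_mul Q_group Qp Qq).
Qed.

Lemma orb_sub Y y : act_stable Q act Y -> Y y -> orb Q act y `<=` Y.
Proof. by move=> Yq Yy _ [q Qq <-]; exact: Yq. Qed.

Lemma finite_orb y : finite_set (orb Q act y).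
Proof. exact: finite_image. Qed.

Lemma stableU Y Z : act_stable Q act Y -> act_stable Q act Z -> act_stable Q act (Y `|` Z).
Proof. by move=> Yq Zq q y Qq [Yy|Zy]; [left; exact: Yq | right; exact: Zq]. Qed.

Lemma stableD Y Z : act_stable Q act Y -> act_stable Q act Z -> act_stable Q act (Y `\` Z).
Proof.
move=> Yq Zq q y Qq [Yy nZ]; split; first exact: Yq.
move=> Zqy; apply: nZ; rewrite -(actK Q_group aut_actP y Qq); apply: Zq => //.
exact: (group_closed_inv Q_group Qq).
Qed.

Lemma stable_alps i Y : act_stable Q act Y -> act_stable Q act (alps i Y).
Proof.
move=> Yq q _ Qq [y Yy [j _ <-]]; exists (q y); first exact: Yq.
by exists j => //; rewrite /aut_act aut_alp.
Qed.

(** One orbit gives way to the [n i] orbits of its children, all of the same type. On transversals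
    this replaces [m] by its children, which [ncard_expansion] counts. *)
Lemma orbit_expansion i Y m (Y' := (Y `\` orb Q act m) `|` alps i (orb Q act m)) :
  fixed_admissible Q Y -> Y m -> fixed_admissible Q Y' /\
  forall T, (typed act T m -> cnt T Y' = cnt T Y + (n i).-1) /\
            (~ typed act T m -> cnt T Y' = cnt T Y).
Proof.
move=> Yf; have /fixed_admissibleP[Ya Yq] := Yf; have Yb := admissible_basis Ya.
have [M MY] := fixed_reps Yf; have [MsY YM MI] := MY.
wlog Mm : m @Y' / M m => [wl|Ym].
  move=> Ym; have [q Qq Mq] := YM m Ym.
  have := wl (act q m) Mq (MsY _ Mq); rewrite (orb_act Q_group aut_actP) // -/Y'.
  move=> [Y'f c]; split=> // T; have [c1 c2] := c T; split=> Tm.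
    by apply: c1; exact: typed_act_stable.
  apply: c2 => Tqm; apply: Tm; rewrite -(actK Q_group aut_actP m Qq).
  by apply: typed_act_stable => //; exact: (group_closed_inv Q_group Qq).
have Y'f : fixed_admissible Q Y'.
  apply/fixed_admissibleP; split.
    apply: admissible_expands Ya _; apply: expands_alps => //.
    - exact: cantor_alp_lamK.
    - exact: finite_orb.
    - exact: orb_sub.
  apply: stableU; first exact: stableD Yq (@orb_stable m).
  exact/stable_alps/orb_stable.
have orbM m' : M m' -> orb Q act m m' -> m' = m.
  by move=> Mm' [q Qq e]; rewrite -e; apply: MI => //; rewrite e.
pose ms := range (fun j : 'I_(n i) => alp i j m).
have basis_notin := basis_notin_alp (@cantor_alp_lamK _ _ S2 X) U_nontrivial Yb.
have M'Y' : orbit_reps Q act ((M `\ m) `|` ms) Y'.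
  split.
  - move=> u [[Mu um]|[j _ <-]].
      by left; split; [exact: MsY | move=> /(orbM _ Mu)].
    by right; exists m; [exact: (orb_refl Q_group aut_actP) | exists j].
  - move=> u [[Yu nu]|[_ [q Qq <-] [j _ <-]]].
      have [q Qq Mq] := YM u Yu; exists q => //; left; split=> // e; apply: nu.
      by rewrite -(orb_act Q_group aut_actP m (group_closed_inv Q_group Qq)) -e
        (actK Q_group aut_actP) //; exact: (orb_refl Q_group aut_actP).
    exists (q^-1)%g; first exact: (group_closed_inv Q_group Qq).
    by right; exists j => //; rewrite /aut_act -aut_alp aut_invVK.
  - move=> u q + Qq; rewrite /aut_act => -[[Mu um]|[j _ <-]].
      move=> [[Mqu _]|[j _ e]]; first exact: MI.
      case: um; have Yqu : Y (q u) by apply: Yq => //; exact: MsY.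
      have /(congr1 (orb Q act)) := basis_notin _ _ _ _ (MsY _ Mm) Yqu e.
      rewrite (orb_act Q_group aut_actP u Qq) => e'; apply: orbM => //.
      by rewrite e'; exact: (orb_refl Q_group aut_actP).
    rewrite aut_alp => -[[Mqm _]|[k _ e]].
      have Yqm : Y (q m) by apply: Yq => //; exact: MsY.
      have e := basis_notin _ _ _ _ Yqm (MsY _ Mqm) erefl.
      have qm : q m = m by apply: MI => //; rewrite /aut_act e.
      by rewrite qm.
    congr (alp i j _); apply/esym.
    apply: (@cantor_wact_inj Y m (q m) [:: Tagged _ k] [:: Tagged _ j]) => //.
    exact: Yq.
split=> // T; rewrite (cnt_reps _ M'Y') (cnt_reps _ MY).
have Tms j : typed act T (alp i j m) <-> typed act T m.
  exact: (@typed_wact T Y m [:: Tagged _ j]).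
split=> Tm.
  rewrite -(ncard_expansion (@cantor_alp_lamK _ _ S2 X) U_nontrivial arity_gt1 i Yb
    (p := m) (P := M `&` typed act T)) //.
  - congr ncard; apply/seteqP; split=> u.
      by move=> [[[Mu um]|ums] Tu]; [left | right].
    by move=> [[[Mu Tu] um]|[j _ <-]]; [split=> //; left | split; [right; exists j|apply/Tms]].
  - by apply: finite_setIl; exact: sub_finite_set MsY (admissible_finite Ya).
  - by move=> u [Mu _]; exact: MsY.
congr ncard; apply/seteqP; split=> u.
  by move=> [[[Mu um]|[j _ <-]] // /Tms].
by move=> [Mu Tu]; split=> //; left; split=> // um; apply: Tm; rewrite -um.
Qed.

Lemma lam_same_stab i (a : 'I_(n i) -> U) q :
  q (lam i a) = lam i a <-> forall j, q (a j) = a j.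
Proof.
rewrite aut_lam; split=> [/(lam_inj (@cantor_alp_lamK _ _ S2 X))//|e].
by congr (lam i); apply/funext.
Qed.

(* The contraction [Y'] of [n i] orbits of type [T] is recovered as the set  *)
(* whose orbit expansion is [Y]; the counts then follow from                 *)
(* [orbit_expansion].                                                        *)
Lemma orbit_contraction i Y T : fixed_admissible Q Y -> n i <= cnt T Y ->
  exists c Y', [/\ fixed_admissible Q Y', Y' c, typed act T c &
    Y = (Y' `\` orb Q act c) `|` alps i (orb Q act c)].
Proof.
move=> Yf; have /fixed_admissibleP[Ya Yq] := Yf; have Yb := admissible_basis Ya.
have [M MY] := fixed_reps Yf; have [MsY YM MI] := MY.
rewrite (cnt_reps _ MY) => le_n.
have fMT : finite_set (M `&` typed act T).
  by apply: finite_setIl; exact: sub_finite_set MsY (admissible_finite Ya).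
have [b [bM bI]] : exists b : 'I_(n i) -> U,
    (forall j, (M `&` typed act T) (b j)) /\ injective b.
  have [u0 _] := U_nontrivial.
  have [f [fP fI _]] := card_eq_set_bij u0 (card_esym (ncardP fMT)).
  have lt_j (j : 'I_(n i)) : j < ncard (M `&` typed act T).
    exact: leq_trans (ltn_ord j) le_n.
  exists (fun j => f j); split=> [j|j k e]; first by apply: fP; exact: lt_j.
  by apply/val_inj/fI; rewrite ?inE //; exact: lt_j.
have [x0 _] := ts_trans T.
(* Within their orbits the representatives are moved to points with the stabilizer of [x0]; the
   stabilizer of [lam i a], their intersection, is then the same. *)
have /choice[a aP] : forall j, exists a, [/\ Y a, orb Q act a = orb Q act (b j) &
    same_stab Q act (@trans_act _ _ T) a x0].
  move=> j; have [Mb [x bx]] := bM j.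
  have [q Qq e] := trans_act_transitive Q_group x x0.
  exists (act q (b j)); split; first by apply: Yq => //; exact: MsY.
    exact: (orb_act Q_group aut_actP).
  by rewrite -e; apply: same_stab_act => //; exact: trans_actP.
have cx : same_stab Q act (@trans_act _ _ T) (lam i a) x0.
  move=> q Qq; rewrite /aut_act lam_same_stab; split=> [e|e j].
    have [_ _ ax] := aP (Ordinal (ltnW (arity_gt1 i))).
    by apply/(ax q Qq); exact: e.
  by have [_ _ ax] := aP j; apply/(ax q Qq).
set c := lam i a in cx *; pose P := orb Q act c.
have alpc j q : alp i j (act q c) = act q (a j).
  by rewrite /aut_act -aut_alp cantor_alp_lamK.
(* Children of different index lie in different orbits. For one index, [c] and [a j] have equal
   stabilizers, so equal translates of [a j] come from equal translates of [c]. *)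
have cP : contractible i Y P.
  split=> [_ [_ [q Qq <-] [j _ <-]]|_ _ j k [q Qq <-] [p Qp <-]].
    by rewrite alpc; apply: Yq => //; have [] := aP j.
  rewrite !alpc => e; have jk : j = k.
    apply: bI; have [_ aj _] := aP j; have [_ ak _] := aP k.
    apply: (orbit_reps_orb_inj Q_group aut_actP MY (bM j).1 (bM k).1).
    by rewrite -aj -ak -(orb_act Q_group aut_actP (a j) Qq) e
      (orb_act Q_group aut_actP).
  split=> //; rewrite -jk in e.
  have [_ _ ax] := aP j; have Tact := trans_actP T.
  apply/(same_stab_eq Q_group aut_actP Tact Qq Qp cx).
  exact/(same_stab_eq Q_group aut_actP Tact Qq Qp ax).
have lamK := @cantor_lam_alpK _ _ S2 X; have alpK := @cantor_alp_lamK _ _ S2 X.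
exists c, ((Y `\` alps i P) `|` P); split.
- apply/fixed_admissibleP; split.
    apply: rt_trans Ya _; apply: (admissible_from_contract lamK alpK) => //.
    exact: finite_orb.
  apply: stableU; last exact: orb_stable.
  by apply: stableD => //; exact/stable_alps/orb_stable.
- by right; exact: (orb_refl Q_group aut_actP).
- by exists x0.
- by rewrite (contractK alpK).
Qed.

(** Adjusts one orbit count at a time. Types are identified through their sets of points, which
    avoids choosing one transitive set per isomorphism class. *)
Definition reachable Y T m : Prop :=
  exists Y', [/\ fixed_admissible Q Y', cnt T Y' = m &
    forall T', typed act T' = typed act T \/ cnt T' Y' = cnt T' Y].

Lemma typed_inter_eq T T' y : typed act T y -> typed act T' y ->
  typed act T' = typed act T.
Proof. by move=> yT yT'; apply: (typed_eq Q_group); exact: typed_iso yT' yT. Qed.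

(** Expand one orbit to go up, contract [n i] orbits to go down; [0 < m] supplies the orbits needed
    in both cases. *)
Lemma reachable_arity Y T i m : 0 < m ->
  reachable Y T m <-> reachable Y T (m + (n i).-1).
Proof.
move=> m0; split=> -[Y' [Y'f Ym YT]].
  have [|y Y'y Ty] := (cnt_gt0P T Y'f).1; first by rewrite Ym.
  have [Zf Zc] := orbit_expansion i Y'f Y'y.
  eexists; split; [exact: Zf| by rewrite (Zc T).1 // Ym |].
  move=> T'; case: (YT T') => e; first by left.
  case: (pselect (typed act T' y)) => T'y.
    by left; exact: typed_inter_eq Ty T'y.
  by right; rewrite (Zc T').2.
have [|c [Z [Zf Zc Tc ZY']]] := @orbit_contraction i Y' T Y'f.
  by rewrite Ym -[X in X <= _](prednK (ltnW (arity_gt1 i))) -add1n leq_add2r.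
have [_] := orbit_expansion i Zf Zc; rewrite -ZY' => cZ; exists Z; split=> //.
  by apply/(@addIn (n i).-1); rewrite -(cZ T).1.
move=> T'; case: (YT T') => e; first by left.
case: (pselect (typed act T' c)) => T'c.
  by left; exact: typed_inter_eq Tc T'c.
by right; rewrite -e (cZ T').2.
Qed.

Lemma reachable_gcd Y T m : 0 < m ->
  reachable Y T m <-> reachable Y T (m + gcd_arities n).
Proof.
rewrite /gcd_arities; elim/big_ind: _ m => [m _|k l IHk IHl|i _ m].
- by rewrite addn0.
- exact: shift_gcdn.
- exact: reachable_arity.
Qed.

Lemma reachable_reduced Y T : fixed_admissible Q Y ->
  exists2 m, m <= gcd_arities n & reachable Y T m.
Proof.
move=> Yf; have : reachable Y T (cnt T Y) by exists Y; split=> //; right.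
elim/ltn_ind: (cnt T Y) => m IH Ym; case: (leqP m (gcd_arities n)) => [le_m|lt_m].
  by exists m.
apply: (IH (m - gcd_arities n)).
  by rewrite ltn_subrL gcd_arities_gt0 (leq_ltn_trans _ lt_m).
by apply/reachable_gcd; rewrite ?subn_gt0 // subnK // ltnW.
Qed.

Lemma reduced_exists : exists2 Y, fixed_admissible Q Y &
  forall T, cnt T Y <= gcd_arities n.
Proof.
have [Y Yf] := fixed_exists arity_gt1 U_nontrivial U_bounded Q_sub Q_fin.
(* [L] holds the types whose count may still exceed d, finitely many since [Y] is finite; each
   induction step reduces one and leaves the others unchanged. *)
suff main (L : set (set U)) : finite_set L -> forall Y, fixed_admissible Q Y ->
    (forall T, cnt T Y <= gcd_arities n \/ L (typed act T)) ->
    exists2 Y, fixed_admissible Q Y & forall T, cnt T Y <= gcd_arities n.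
  have /choice[t tP] := fun y => typed_exists Q_group y aut_actP Q_fin.
  apply: (main ((fun y => typed act (t y)) @` Y) _ Y Yf).
    exact/finite_image/admissible_finite/Yf.1.
  move=> T; case: (posnP (cnt T Y)) => [->|]; first by left.
  by move=> /(cnt_gt0P T Yf)[y Yy Ty]; right; exists y => //; exact: typed_inter_eq Ty (tP y).
move=> {Y Yf}; move: L; apply: finite_set_ind => [|K L _ _ IH] Y Yf YL.
  by exists Y => // T; case: (YL T).
case: (pselect (exists T, typed act T = K)) => [[T TK]|nK]; last first.
  by apply: (IH Y) => // T; case: (YL T) => [|[TK|]]; [left|case: nK; exists T|right].
have [m le_m [Y' [Y'f Ym Y'T]]] := reachable_reduced T Yf.
apply: (IH Y' Y'f) => T'.
case: (pselect (typed act T' = typed act T)) => [e|ne]; first by left; rewrite e Ym.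
case: (Y'T T') => [//|->]; case: (YL T') => [|[T'K|]]; [by left| |by right].
by case: ne; rewrite TK.
Qed.

End FixedCount.

(** * Conjugacy and the invariant pi *)

Section GroupIso.
Variables (G : groupType) (P Q : set G) (psi : G -> G).
Hypothesis P_group : group_closed (mem P).
Hypothesis Q_group : group_closed (mem Q).
Hypothesis psi_iso : group_iso P Q psi.

Lemma group_isoM p q : P p -> P q -> psi (p * q)%g = (psi p * psi q)%g.
Proof. by move=> Pp Pq; apply: psi_iso.2; rewrite inE. Qed.

Lemma group_iso1 : psi 1%g = 1%g.
Proof.
have P1 := group_closed1 P_group.
by apply: (@mulgI _ (psi 1%g)); rewrite -group_isoM // !mulg1.
Qed.

Lemma group_iso_image : psi @` P = Q.
Proof.
have [[fP _ sP] _] := psi_iso.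
by apply/seteqP; split=> // _ [p Pp <-]; exact: fP.
Qed.

Lemma group_iso_action (U : Type) (rho : G -> U -> U) :
  is_action Q rho -> is_action P (fun p => rho (psi p)).
Proof.
move=> [r1 rM]; split=> [u|p q u Pp Pq]; first by rewrite group_iso1.
have [[fP _ _] _] := psi_iso.
by rewrite group_isoM // rM //; exact: fP.
Qed.

Lemma group_iso_typed (U : Type) (rho : G -> U -> U) (T1 : trans_set P)
    (T2 : trans_set Q) :
  same_type psi T1 T2 -> typed rho T2 = typed (fun p => rho (psi p)) T1.
Proof.
move=> [b [b' bK b'K] bE]; have bI := can_inj bK; have [[fP _ sP] _] := psi_iso.
apply/seteqP; split=> y [x yx].
  exists (b' x) => p Pp; rewrite (yx _ (fP _ Pp)) /trans_act -{1 2}(b'K x) -bE //.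
  by split=> [/bI|->].
exists (b x) => q /sP[p Pp <-]; rewrite (yx p Pp) /trans_act -bE //.
by split=> [->|/bI].
Qed.

Lemma group_iso_count (U : Type) (rho : G -> U -> U) (T1 : trans_set P)
    (T2 : trans_set Q) (Y : set U) : same_type psi T1 T2 ->
  orbit_count Q rho (typed rho T2) Y =
  orbit_count P (fun p => rho (psi p)) (typed (fun p => rho (psi p)) T1) Y.
Proof.
move=> /(group_iso_typed rho)->; congr ncard; apply: eq_imagel => y _.
by rewrite /orb -{1}group_iso_image image_comp.
Qed.

Lemma group_iso_push (T1 : trans_set P) : exists T2 : trans_set Q, same_type psi T1 T2.
Proof.
have [[fP psiI sP] _] := psi_iso.
have /choice[chi chiP] : forall q, exists p, Q q -> P p /\ psi p = q.
  move=> q; case: (pselect (Q q)) => [/sP[p Pp pq]|?]; last by exists 1%g.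
  by exists p.
have chiK p : P p -> chi (psi p) = p.
  move=> Pp; have [Pc e] := chiP _ (fP _ Pp).
  by apply: psiI; rewrite ?inE.
(* The action transported along the inverse [chi] of [psi]; [x] is only a default off [Q]. *)
pose act2 (x : T1) q := if `[< Q q >] then ts_act x (chi q) else x.
have act2E x q : Q q -> act2 x q = ts_act x (chi q) by move=> Qq; rewrite /act2 asboolT.
have chi1 : chi 1%g = 1%g by rewrite -{1}group_iso1 chiK //; exact: (group_closed1 P_group).
have a1 x : act2 x 1%g = x.
  by rewrite act2E ?chi1 ?ts_act1 //; exact: (group_closed1 Q_group).
have aM x p q : Q p -> Q q -> act2 x (p * q)%g = act2 (act2 x p) q.
  move=> Qp Qq; have [[Pp ep] [Pq eq]] := (chiP p Qp, chiP q Qq).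
  rewrite !act2E //; last exact: (group_closed_mul Q_group Qp Qq).
  rewrite -[X in chi (X * _)%g]ep -[X in chi (_ * X)%g]eq -group_isoM // chiK ?ts_actM //.
  exact: (group_closed_mul P_group Pp Pq).
have aT : exists x, forall y, exists2 q, Q q & act2 x q = y.
  have [x xT] := ts_trans T1; exists x => y; have [p Pp <-] := xT y.
  by exists (psi p); rewrite ?act2E ?chiK //; exact: fP.
exists (TransSet a1 aM aT), id; first by exists id.
by move=> x p Pp /=; rewrite act2E ?chiK //; exact: fP.
Qed.

End GroupIso.

Lemma group_iso_id (G : groupType) (P : set G) : group_iso P P id.
Proof. by split=> //; split=> // x Px; exists x. Qed.

Lemma orbit_count_equivariant (G : groupType) (P : set G) (U : Type)
    (rho sigma : G -> U -> U) (g : U -> U) (T : trans_set P) (Y : set U) :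
  injective g -> (forall p u, P p -> g (rho p u) = sigma p (g u)) ->
  orbit_count P sigma (typed sigma T) (g @` Y) = orbit_count P rho (typed rho T) Y.
Proof.
move=> gI gE.
have typedE y : typed sigma T (g y) <-> typed rho T y.
  split=> -[x yx]; exists x => p Pp; rewrite -yx // -gE //.
    by split=> [->|/gI].
  by split=> [/gI|->].
have orbE y : orb P sigma (g y) = g @` orb P rho y.
  by rewrite /orb image_comp; apply: eq_imagel => p Pp /=; rewrite gE.
rewrite /orbit_count -[RHS](@ncard_image _ _ (fun O => g @` O)).
  congr ncard; apply/seteqP; split=> O.
    move=> [z [[y Yy e] Ty] <-]; rewrite -e in Ty *; exists (orb P rho y); last by rewrite orbE.
    by exists y => //; split=> //; apply/typedE.
  move=> [_ [y [Yy Ty] <-] <-]; exists (g y); last exact: orbE.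
  by split; [exists y | apply/typedE].
move=> O O' _ _ e; apply/seteqP; split=> u Ou.
  by have : (g @` O') (g u) by [rewrite -e; exists u]; move=> [v O'v /gI <-].
by have : (g @` O) (g u) by [rewrite e; exists u]; move=> [v O'v /gI <-].
Qed.

(** * Conjugacy, orbit counts and finiteness of the set of classes *)

Section Conjugation.
Variables (s : nat) (n : 'I_s -> nat) (S2 : sigma2 n) (X : finType).
Let U := cantor S2 X.
Hypothesis s_gt0 : 0 < s.
Hypothesis arity_gt1 : forall i, 1 < n i.
Hypothesis U_nontrivial : exists u v : U, u <> v.
Hypothesis U_bounded : bounded S2 X.
Implicit Types (Q : set (omega_aut U)) (Y Z : set U) (g h : omega_aut U).

Local Notation act := (@aut_act s n U).
Local Notation cnt Q T Y := (orbit_count Q act (typed act T) Y).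

(** Freeness extends the bijection and its inverse to endomorphisms; uniqueness on [V] and [W] makes
    these mutually inverse. *)
Lemma aut_of_bij V W (b : U -> U) : admissible V -> admissible W ->
  set_bij V W b -> exists g : omega_aut U, forall v, V v -> g v = b v.
Proof.
move=> Va Wa [bVW bI bS].
have [Vfree Vgen] := admissible_basis Va; have [Wfree Wgen] := admissible_basis Wa.
have /choice[b' b'P] : forall w, exists v, W w -> V v /\ b v = w.
  move=> w; case: (pselect (W w)) => [/bS[v Vv vw]|?]; last by exists w.
  by exists v.
have [f [fl fa] fb] := Vfree b; have [f' [fl' fa'] fb'] := Wfree b'.
have fK : cancel f f'.
  apply: (Vgen (f' \o f) id) => //.
    by split=> [i a|i j u] /=; [rewrite fl fl' | rewrite fa fa'].
  move=> v Vv /=; have Wbv := bVW v Vv; have [Vb bb] := b'P _ Wbv.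
  by rewrite fb // fb' //; apply: bI; rewrite ?inE.
have f'K : cancel f' f.
  apply: (Wgen (f \o f') id) => //.
    by split=> [i a|i j u] /=; [rewrite fl' fl | rewrite fa' fa].
  by move=> w Ww /=; have [Vb bb] := b'P _ Ww; rewrite fb' // fb.
by exists (Aut fK f'K fl fa).
Qed.

Lemma GrP g : Gr S2 X g <-> admissible (g @` @cantor_gens s n S2 X).
Proof.
have Xa : admissible (@cantor_gens s n S2 X) by exact: rt_refl.
split=> [/Gr_admissible|gXa]; first exact.
exists (@cantor_gens s n S2 X), (g @` @cantor_gens s n S2 X); split=> //.
split=> [u Xu|u v _ _ /aut_inj //|//]; by exists u.
Qed.

Lemma Gr_mul g h : Gr S2 X g -> Gr S2 X h -> Gr S2 X (g * h)%g.
Proof.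
move=> /GrP gX hG; apply/GrP; rewrite image_autM; exact: Gr_admissible.
Qed.

Lemma Gr_inv g : Gr S2 X g -> Gr S2 X (g^-1)%g.
Proof.
move=> /GrP gX; have Xa : admissible (@cantor_gens s n S2 X) by exact: rt_refl.
apply/GrP; have := admissible_from_aut (g^-1)%g (admissible_connected arity_gt1 U_nontrivial gX Xa).
by rewrite image_autVK.
Qed.

Lemma conj_setM Q g h : conj_set (conj_set Q g) h = conj_set Q (g * h)%g.
Proof. by rewrite /conj_set image_comp; apply: eq_imagel => q _ /=; rewrite conjgM. Qed.

Lemma conj_class_eq Q Q' : conjugate_in (Gr S2 X) Q Q' ->
  conj_class (Gr S2 X) Q = conj_class (Gr S2 X) Q'.
Proof.
move=> [g Gg ->]; apply/seteqP; split=> _ [h Gh ->].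
  exists (g^-1 * h)%g; first by apply: Gr_mul => //; exact: Gr_inv.
  by rewrite conj_setM mulgA mulgV mul1g.
by exists (g * h)%g; [exact: Gr_mul | rewrite conj_setM].
Qed.

Lemma of_typeP Q (T : trans_set Q) y : group_closed (mem Q) ->
  of_type T (orb Q act y) <-> typed act T y.
Proof.
move=> Q_group; have yy := orb_refl Q_group (aut_actP Q) y; split.
  move=> [b [_ bI _] bE]; exists (b y) => q Qq; rewrite /trans_act -bE //.
  split=> [/(congr1 b)//|e]; apply: bI; rewrite ?inE //; by exists q.
move=> [x yx]; have Tact := trans_actP T.
have eqE p q : Q p -> Q q -> act p y = act q y <-> trans_act p x = trans_act q x.
  by move=> Qp Qq; exact: (same_stab_eq Q_group (aut_actP Q) Tact Qp Qq yx).
have [b [bij bR]] : exists b, set_bij (orb Q act y) [set: T] b /\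
    forall u, orb Q act y u -> exists2 q, Q q & u = act q y /\ b u = trans_act q x.
  have [|||b [bij bR]] := @set_bij_of_rel U T x
      (fun u z => exists2 q, Q q & u = act q y /\ z = trans_act q x) (orb Q act y) setT.
  - by move=> _ [q Qq <-]; exists (trans_act q x) => //; exists q.
  - move=> z _; have [q Qq e] := trans_act_transitive Q_group x z.
    by exists (act q y); exists q.
  - by move=> _ _ _ _ [p Pp [-> ->]] [q Qq [-> ->]]; exact: (eqE p q Pp Qq).
  by exists b.
exists b => // u q Ou Qq; have [p Qp [-> ->]] := bR u Ou.
have Qpq := group_closed_mul Q_group Qp Qq.
have Opq : orb Q act y (act (p * q)%g y) by exists (p * q)%g.
have [r Qr [er br]] := bR _ Opq.
rewrite -[q (act p y)]/(act (p * q)%g y) br -[RHS]/(trans_act q (trans_act p x)).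
by rewrite -Tact.2 //; apply/eqE.
Qed.

Lemma orbits_of_type Q (T : trans_set Q) Y m : group_closed (mem Q) -> finite_set Y ->
  (orbits Q Y `&` [set O | of_type T O]) #= `I_m <-> cnt Q T Y = m.
Proof.
move=> Q_group Yfin.
have -> : orbits Q Y `&` [set O | of_type T O] =
    [set orb Q act y | y in Y `&` typed act T].
  apply/seteqP; split=> O.
    by move=> [[y Yy <-] /(of_typeP _ _ Q_group) Ty]; exists y.
  by move=> [y [Yy Ty] <-]; split; [exists y | apply/(of_typeP _ _ Q_group)].
split=> [/ncard_unique //|<-]; apply: ncardP.
by apply: finite_image; exact: finite_setIl.
Qed.

Lemma is_piP Q (p : trans_set Q -> nat) : group_closed (mem Q) ->
  is_pi p <-> (forall T, p T <= gcd_arities n) /\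
    exists2 Y, fixed_admissible Q Y & forall T, cnt Q T Y = p T.
Proof.
move=> Q_group; split=> -[pd [Y Yf Yp]]; split=> //; exists Y => // T.
  by apply/orbits_of_type => //; exact: admissible_finite Yf.1.
by apply/orbits_of_type => //; exact: admissible_finite Yf.1.
Qed.

(** [pi_inv] is an epsilon term; the reduced set shows its specification satisfiable. *)
Lemma pi_invP Q : subgroup_of (Gr S2 X) Q -> finite_set Q ->
  (forall T : trans_set Q, pi_inv T <= gcd_arities n) /\
  exists2 Y, fixed_admissible Q Y & forall T : trans_set Q, cnt Q T Y = pi_inv T.
Proof.
move=> Q_sub Q_fin; apply/is_piP; first exact: (proj2 Q_sub).
apply: epsilon_spec.
have [Y Yf Yd] := reduced_exists s_gt0 arity_gt1 U_nontrivial U_bounded Q_sub Q_fin.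
by exists (fun T => cnt Q T Y); apply/is_piP; [exact: (proj2 Q_sub)|split=> //; exists Y].
Qed.

(** Both fixed sets become [P]-sets with equal counts. An equivariant bijection between them extends
    to [g], and conjugation by [g] takes [psi1 p] to [psi2 p], as is checked on the basis [Y2]. *)
Lemma conjugate_of_counts (P Q1 Q2 : set (omega_aut U)) psi1 psi2 Y1 Y2 :
  group_closed (mem P) -> finite_set P ->
  subgroup_of (Gr S2 X) Q1 -> subgroup_of (Gr S2 X) Q2 ->
  group_iso P Q1 psi1 -> group_iso P Q2 psi2 ->
  fixed_admissible Q1 Y1 -> fixed_admissible Q2 Y2 ->
  (forall T : trans_set P,
    orbit_count P (fun p => act (psi1 p)) (typed (fun p => act (psi1 p)) T) Y1 =
    orbit_count P (fun p => act (psi2 p)) (typed (fun p => act (psi2 p)) T) Y2) ->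
  conjugate_in (Gr S2 X) Q1 Q2.
Proof.
move=> P_group P_fin Q1s Q2s iso1 iso2 Y1f Y2f counts.
have /(fixed_admissibleP Q1s)[Y1a Y1s] := Y1f.
have /(fixed_admissibleP Q2s)[Y2a Y2s] := Y2f.
have [u0 _] := U_nontrivial.
have [[f1 _ _] _] := iso1; have [[f2 _ _] _] := iso2.
have [||||b [bij bE]] := equivariant_bijection u0 P_group P_fin
  (group_iso_action P_group iso1 (aut_actP Q1))
  (group_iso_action P_group iso2 (aut_actP Q2)) _ _ _ _ counts.
- by move=> p y Pp; apply: Y1s; exact: f1.
- by move=> p y Pp; apply: Y2s; exact: f2.
- exact: admissible_finite.
- exact: admissible_finite.
have [g gb] := aut_of_bij Y1a Y2a bij.
have gbij : set_bij Y1 Y2 g.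
  have [bY bI bS] := bij; split=> [y Yy|y y' _ _ /aut_inj//|z /bS[y Yy <-]].
    by rewrite gb //; exact: bY.
  by exists y => //; exact: gb.
exists g; first by exists Y1, Y2.
have [_ Y2gen] := admissible_basis Y2a.
have conjE p : P p -> psi2 p = (psi1 p ^ g)%g.
  move=> Pp; apply: aut_eq; apply: Y2gen => [||z Y2z]; try exact: aut_endo.
  have [_ _ /(_ z Y2z)[y Y1y <-]] := gbij.
  rewrite /conjg !aut_mulE aut_invVK gb // gb; last by apply: Y1s => //; exact: f1.
  by rewrite -[RHS]/(b (act (psi1 p) y)) bE.
rewrite -(group_iso_image iso2) -(group_iso_image iso1) /conj_set image_comp.
by apply: eq_imagel => p Pp /=; exact: conjE.
Qed.

Lemma finite_group_iso (P Q : set (omega_aut U)) psi :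
  group_iso P Q psi -> finite_set P -> finite_set Q.
Proof. by move=> /group_iso_image <-; exact: finite_image. Qed.

(** The isomorphism is conjugation by [g]: the image of a reduced set of [Q1] is fixed by [Q2] with
    the same counts, and reduced counts are unique. *)
Lemma conjugate_pi_eq Q1 Q2 : subgroup_of (Gr S2 X) Q1 -> subgroup_of (Gr S2 X) Q2 ->
  finite_set Q1 -> finite_set Q2 -> conjugate_in (Gr S2 X) Q1 Q2 -> pi_eq Q1 Q2.
Proof.
move=> Q1s Q2s Q1f Q2f [g Gg Q2E].
pose psi (q : omega_aut U) : omega_aut U := (q ^ g)%g.
have psi_iso : group_iso Q1 Q2 psi.
  split; last by move=> p q _ _; rewrite /psi conjMg.
  rewrite Q2E; split=> [q Qq|p q _ _ /conjg_inj //|_ [q Qq <-]]; by exists q.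
exists psi => // T1 T2 T12.
have [d1 [Y1 Y1f c1]] := pi_invP Q1s Q1f; have [d2 [Y2 Y2f c2]] := pi_invP Q2s Q2f.
have gY1f : fixed_admissible Q2 (g @` Y1).
  split; first exact: Gr_admissible Y1f.1.
  move=> q; rewrite -(group_iso_image psi_iso) => -[p Qp <-].
  by rewrite /psi /conjg !image_autM image_autVK Y1f.2.
have cE : cnt Q2 T2 (g @` Y1) = cnt Q1 T1 Y1.
  rewrite (group_iso_count psi_iso act (g @` Y1) T12).
  apply: orbit_count_equivariant; first exact: aut_inj.
  by move=> p u _; rewrite /aut_act /psi /conjg !aut_mulE aut_invVK.
rewrite -c1 -c2 -cE.
apply: (cnt_unique s_gt0 arity_gt1 U_nontrivial U_bounded Q2s Q2f) => //.
- by rewrite cE c1.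
- by rewrite c2.
Qed.

Lemma pi_eq_conjugate Q1 Q2 : subgroup_of (Gr S2 X) Q1 -> subgroup_of (Gr S2 X) Q2 ->
  finite_set Q1 -> finite_set Q2 -> pi_eq Q1 Q2 -> conjugate_in (Gr S2 X) Q1 Q2.
Proof.
move=> Q1s Q2s Q1f Q2f [psi psi_iso piE].
have Q1g : group_closed (mem Q1) by exact: (proj2 Q1s).
have Q2g : group_closed (mem Q2) by exact: (proj2 Q2s).
have [_ [Y1 Y1f c1]] := pi_invP Q1s Q1f; have [_ [Y2 Y2f c2]] := pi_invP Q2s Q2f.
apply: (conjugate_of_counts Q1g Q1f Q1s Q2s (group_iso_id Q1) psi_iso Y1f Y2f) => T1.
have [T2 T12] := group_iso_push Q1g Q2g psi_iso T1.
by rewrite -(group_iso_count psi_iso act Y2 T12) c2 -(piE _ _ T12) -c1.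
Qed.

(** A point stabilizer determines the type, and [P] has finitely many subsets. *)
Lemma finite_trans_types (P : set (omega_aut U)) :
  group_closed (mem P) -> finite_set P ->
  exists (I : finType) (t : I -> trans_set P), forall T, exists i, trans_iso T (t i).
Proof.
move=> P_group P_fin; have /finite_seqP[l Pl] := P_fin.
have [u0 _] := U_nontrivial.
have [T0 _] := typed_exists P_group u0 (aut_actP P) P_fin.
have /choice[stab stabP] : forall T : trans_set P, exists H : {set seq_sub l},
    exists x : T, forall q : seq_sub l, q \in H <-> ts_act x (val q) = x.
  move=> T; have [x _] := ts_trans T.
  exists [set q : seq_sub l | `[< ts_act x (val q) = x >]]%SET, x => q.
  by rewrite finset.inE; split=> /asboolP.
have /choice[c cP] : forall H, exists T, forall T', stab T' = H -> stab T = H.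
  move=> H; case: (pselect (exists T, stab T = H)) => [[T TH]|nH]; first by exists T.
  by exists T0 => T' T'H; case: nH; exists T'.
exists {set seq_sub l}, c => T; exists (stab T).
have [x xH] := stabP T; have [x' x'H] := stabP (c (stab T)).
exists x, x' => q Pq; have lq : q \in l by move: Pq; rewrite Pl.
have := xH (SeqSub lq); have := x'H (SeqSub lq); rewrite (cP _ T erefl) => e' e.
exact: iff_trans (iff_sym e) e'.
Qed.

(** The counts of a reduced fixed set, read through an isomorphism from [P], form a tuple in 0..d
    that determines the class. *)
Lemma finite_conj_classes (P : set (omega_aut U)) :
  group_closed (mem P) -> finite_set P ->
  finite_set [set C : set (set (omega_aut U)) | exists Q,
    [/\ subgroup_of (Gr S2 X) Q, isomorphic P Q & C = conj_class (Gr S2 X) Q]].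
Proof.
move=> P_group P_fin; have [I [t tP]] := finite_trans_types P_group P_fin.
pose d := gcd_arities n.
pose pcnt psi T Y :=
  orbit_count P (fun p => act (psi p)) (typed (fun p => act (psi p)) (T : trans_set P)) Y.
pose has_counts (D : {ffun I -> 'I_d.+1}) Q := subgroup_of (Gr S2 X) Q /\
  exists psi Y, [/\ group_iso P Q psi, fixed_admissible Q Y &
    forall i, pcnt psi (t i) Y = D i].
have has_counts_conj D Q Q' : has_counts D Q -> has_counts D Q' ->
    conjugate_in (Gr S2 X) Q Q'.
  move=> [Qs [psi [Y [iso Yf c]]]] [Q's [psi' [Y' [iso' Y'f c']]]].
  apply: (conjugate_of_counts P_group P_fin Qs Q's iso iso' Yf Y'f) => T.
  have [i Ti] := tP T.
  rewrite (typed_eq P_group (fun p => act (psi p)) Ti).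
  rewrite (typed_eq P_group (fun p => act (psi' p)) Ti).
  by rewrite [LHS]c [RHS]c'.
(* [f D] realizes [D] whenever some subgroup does; the default [P] can only add an element to a
   finite image. *)
have /choice[f fP] : forall D, exists Q, forall Q', has_counts D Q' -> has_counts D Q.
  move=> D; case: (pselect (exists Q, has_counts D Q)) => [[Q DQ]|nD]; first by exists Q.
  by exists P => Q' DQ'; case: nD; exists Q'.
apply: (@sub_finite_set _ _ (range (fun D => conj_class (Gr S2 X) (f D)))); last first.
  exact: finite_image.
move=> _ [Q [Qs [psi iso] ->]]; have Q_fin := finite_group_iso iso P_fin.
have Q_group : group_closed (mem Q) by exact: (proj2 Qs).
have [Y Yf Yd] := reduced_exists s_gt0 arity_gt1 U_nontrivial U_bounded Qs Q_fin.
pose D : {ffun I -> 'I_d.+1} := [ffun i => inord (pcnt psi (t i) Y)].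
have DQ : has_counts D Q.
  split=> //; exists psi, Y; split=> // i; rewrite ffunE inordK //.
  have [T2 iT2] := group_iso_push P_group Q_group iso (t i).
  by rewrite ltnS /pcnt -(group_iso_count iso act Y iT2).
exists D => //; apply: conj_class_eq.
exact: (has_counts_conj D _ _ (fP D Q DQ) DQ).
Qed.

End Conjugation.

Theorem theorem4p3 (s : nat) (hs : (0 < s)%N) (n : 'I_s -> nat)
  (hn : forall i, (1 < n i)%N) (S2 : sigma2 n)
  (r : nat) (hr : (0 < r)%N) (X : finType) (hX : #|X| = r)
  (hvalid : valid S2 X) (hbounded : bounded S2 X)
  (Q1 Q2 : set (omega_aut (cantor S2 X)))
  (hQ1 : subgroup_of (Gr S2 X) Q1) (hQ2 : subgroup_of (Gr S2 X) Q2)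
  (fQ1 : finite_set Q1) (fQ2 : finite_set Q2)
  (hiso : isomorphic Q1 Q2) :
  (conjugate_in (Gr S2 X) Q1 Q2 <-> pi_eq Q1 Q2)
  /\ finite_set [set C : set (set (omega_aut (cantor S2 X))) |
       exists Q, [/\ subgroup_of (Gr S2 X) Q, isomorphic Q1 Q
                   & C = conj_class (Gr S2 X) Q]]%classic.
Proof.
have X_gt0 : 0 < #|X| by rewrite hX.
have nontriv := valid_nontrivial hs hn X_gt0 hvalid.
split; last exact: (finite_conj_classes hs hn nontriv hbounded (proj2 hQ1) fQ1).
split; first exact: conjugate_pi_eq.
exact: pi_eq_conjugate.
Qed.
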